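(* There is a certifying algorithm that, given a graph $G=(V,E)$, recognizes in time $O(|V|+|E|)$ whether $G$ is fully threshold-colourable, i.e. whether $G$ admits a full homomorphism to some threshold graph.
   Context: Graphs are finite and undirected, with neither loops nor parallel edges. A full homomorphism from $G$ to $H$ is a function $\varphi\colon V_G\to V_H$ such that, for all $u,v\in V_G$, $uv\in E_G$ if and only if $\varphi(u)\varphi(v)\in E_H$. A threshold graph is a graph with no induced subgraph isomorphic to $2K_2$, $P_4$ or $C_4$. A certifying algorithm is one that, along with its yes/no answer, outputs a certificate of that answer. Here a yes-certificate consists of a colouring of $G$ describing a full homomorphism onto a threshold graph $G'$ together with a certificate that $G'$ is threshold (a partition of its vertices into a clique and an independent set, with a nested neighbourhood ordering); a no-certificate is an induced subgraph of $G$ isomorphic to one of $2K_2$, $P_4$, $\overline{2P_3}$ (the complement of the disjoint union of two paths on three vertices). Graphs are given by adjacency lists. *)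

(* Defs.v *)
From mathcomp Require Import all_boot.

Set Implicit Arguments.
Unset Strict Implicit.
Unset Printing Implicit Defensive.

(** * Graphs *)

Record sgraph (V : finType) := SGraph {
  adj : rel V;
  adj_sym : symmetric adj;
  adj_irr : irreflexive adj }.

Definition edges (V : finType) (G : sgraph V) : {set {set V}} :=
  [set e | [exists u, exists v, adj G u v && (e == [set u; v])]].

Definition neighbours (V : finType) (G : sgraph V) (v : V) : {set V} :=
  [set w | adj G v w].

Lemma complete_sym n : symmetric (fun i j : 'I_n => i != j).
Proof. by move=> i j; rewrite eq_sym. Qed.

Lemma complete_irr n : irreflexive (fun i j : 'I_n => i != j).
Proof. by move=> i; rewrite eqxx. Qed.

Definition complete_graph n : sgraph 'I_n :=
  SGraph (@complete_sym n) (@complete_irr n).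

Definition path_adj n (i j : 'I_n) := (i.+1 == j) || (j.+1 == i).

Lemma path_sym n : symmetric (@path_adj n).
Proof. by move=> i j; rewrite /path_adj orbC. Qed.

Lemma path_irr n : irreflexive (@path_adj n).
Proof. by move=> i; rewrite /path_adj orbb gtn_eqF. Qed.

Definition path_graph n : sgraph 'I_n := SGraph (@path_sym n) (@path_irr n).

Definition cycle_adj n (i j : 'I_n) :=
  (i != j) && ((i.+1 == j %[mod n]) || (j.+1 == i %[mod n])).

Lemma cycle_sym n : symmetric (@cycle_adj n).
Proof. by move=> i j; rewrite /cycle_adj orbC eq_sym. Qed.

Lemma cycle_irr n : irreflexive (@cycle_adj n).
Proof. by move=> i; rewrite /cycle_adj eqxx. Qed.

Definition cycle_graph n : sgraph 'I_n := SGraph (@cycle_sym n) (@cycle_irr n).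

Definition union_adj m n (G : sgraph 'I_m) (H : sgraph 'I_n)
    (i j : 'I_(m + n)) :=
  match split i, split j with
  | inl a, inl b => adj G a b
  | inr a, inr b => adj H a b
  | _, _ => false
  end.

Lemma union_sym m n (G : sgraph 'I_m) (H : sgraph 'I_n) :
  symmetric (union_adj G H).
Proof.
by move=> i j; rewrite /union_adj; case: split; case: split => // a b;
  rewrite adj_sym.
Qed.

Lemma union_irr m n (G : sgraph 'I_m) (H : sgraph 'I_n) :
  irreflexive (union_adj G H).
Proof. by move=> i; rewrite /union_adj; case: split => a; rewrite adj_irr. Qed.

Definition disjoint_union m n (G : sgraph 'I_m) (H : sgraph 'I_n) :
  sgraph 'I_(m + n) := SGraph (union_sym G H) (union_irr G H).

Definition compl_adj (V : finType) (G : sgraph V) (u v : V) :=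
  (u != v) && ~~ adj G u v.

Lemma compl_sym (V : finType) (G : sgraph V) : symmetric (compl_adj G).
Proof. by move=> u v; rewrite /compl_adj eq_sym adj_sym. Qed.

Lemma compl_irr (V : finType) (G : sgraph V) : irreflexive (compl_adj G).
Proof. by move=> u; rewrite /compl_adj eqxx. Qed.

Definition complement (V : finType) (G : sgraph V) : sgraph V :=
  SGraph (compl_sym G) (compl_irr G).

Definition two_K2 := disjoint_union (complete_graph 2) (complete_graph 2).
Definition P4 := path_graph 4.
Definition C4 := cycle_graph 4.
Definition co_two_P3 :=
  complement (disjoint_union (path_graph 3) (path_graph 3)).

Definition induced_embedding (U V : finType) (F : sgraph U) (G : sgraph V)
    (f : U -> V) : Prop :=
  injective f /\ forall x y, adj G (f x) (f y) = adj F x y.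

Definition has_induced (U V : finType) (F : sgraph U) (G : sgraph V) : Prop :=
  exists f : U -> V, induced_embedding F G f.

Definition full_hom (V W : finType) (G : sgraph V) (H : sgraph W)
    (f : V -> W) : Prop :=
  forall u v, adj G u v = adj H (f u) (f v).

Definition threshold (V : finType) (G : sgraph V) : Prop :=
  [/\ ~ has_induced two_K2 G, ~ has_induced P4 G & ~ has_induced C4 G].

Definition fully_threshold_colourable (V : finType) (G : sgraph V) : Prop :=
  exists (W : finType) (H : sgraph W) (f : V -> W),
    threshold H /\ full_hom G H f.

(** * Certificates *)

Inductive obstruction := Obs2K2 | ObsP4 | ObsCo2P3.

Definition obs_size (o : obstruction) : nat :=
  match o with Obs2K2 => 2 + 2 | ObsP4 => 4 | ObsCo2P3 => 3 + 3 end.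

Definition obs_graph (o : obstruction) : sgraph 'I_(obs_size o) :=
  match o with
  | Obs2K2 => two_K2
  | ObsP4 => P4
  | ObsCo2P3 => co_two_P3
  end.

Definition obs_code (o : obstruction) : nat :=
  match o with Obs2K2 => 0 | ObsP4 => 1 | ObsCo2P3 => 2 end.

Definition clique (V : finType) (H : sgraph V) (K : {set V}) : Prop :=
  {in K &, forall x y, x != y -> adj H x y}.

Definition independent (V : finType) (H : sgraph V) (I : {set V}) : Prop :=
  {in I &, forall x y, ~~ adj H x y}.

(* [s] lists each element of [X] once, with N(s_i) \ X nondecreasing; for an
   independent set X, N(s_i) \ X is simply N(s_i). *)
Definition nested_neighbourhood_ordering (V : finType) (H : sgraph V)
    (X : {set V}) (s : seq V) : Prop :=
  [/\ uniq s, s =i X &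
      sorted (fun x y => neighbours H x :\: X \subset neighbours H y :\: X) s].

Definition threshold_certificate (V : finType) (H : sgraph V)
    (K I : {set V}) (s : seq V) : Prop :=
  [/\ K :|: I = [set: V] /\ [disjoint K & I],
      clique H K, independent H I & nested_neighbourhood_ordering H I s].

(* [Yes c K s]: the colouring c, the clique side K of the partition (K, ~: K)
   of the colours, and the ordering s of ~: K. *)
Inductive certificate (n : nat) :=
| Yes k of ('I_n -> 'I_k) & {set 'I_k} & seq 'I_k
| No o of ('I_(obs_size o) -> 'I_n).

Definition is_yes n (w : certificate n) : bool :=
  if w is Yes _ _ _ _ then true else false.

(* As the colouring is onto, the graph H below is determined by it. *)
Definition valid_certificate n (G : sgraph 'I_n) (w : certificate n) : Prop :=
  match w with
  | @Yes _ k c K s => exists H : sgraph 'I_k,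
      [/\ full_hom G H c, forall x, exists v, c v = x, threshold H &
          threshold_certificate H K (~: K) s]
  | @No _ o f => induced_embedding (obs_graph o) G f
  end.

(** * Random access machine *)

(* A structured word RAM: finitely many registers and arrays occur in a given
   program, and one unit of time pays for one assignment, array access or
   test.  Running a program with parameter [W] gets stuck as soon as a value
   larger than [W] is written, so that W + 1 is the number of machine words. *)

Inductive operand := Imm of nat | Reg of nat.

Inductive expr :=
| Val of operand
| Add of operand & operand
| Sub of operand & operand
| Read of nat & operand.

Inductive test := Eq of operand & operand | Lt of operand & operand.

Inductive cmd :=
| Skip
| Assign of nat & expr
| Write of nat & operand & operand
| Seq of cmd & cmd
| If of test & cmd & cmd
| While of test & cmd.

Record state := State { reg : nat -> nat; mem : nat -> nat -> nat }.

Definition oval (s : state) (o : operand) : nat :=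
  match o with Imm k => k | Reg x => reg s x end.

Definition eval (s : state) (e : expr) : nat :=
  match e with
  | Val o => oval s o
  | Add o1 o2 => oval s o1 + oval s o2
  | Sub o1 o2 => oval s o1 - oval s o2
  | Read a o => mem s a (oval s o)
  end.

Definition holds (s : state) (b : test) : bool :=
  match b with
  | Eq o1 o2 => oval s o1 == oval s o2
  | Lt o1 o2 => oval s o1 < oval s o2
  end.

Definition set_reg (s : state) (x v : nat) : state :=
  State (fun y => if y == x then v else reg s y) (mem s).

Definition set_mem (s : state) (a i v : nat) : state :=
  State (reg s)
    (fun b j => if (b == a) && (j == i) then v else mem s b j).

(* [exec W p s t s']: started in s, the program p halts in s' after t steps. *)
Inductive exec (W : nat) : cmd -> state -> nat -> state -> Prop :=
| ExecSkip s : exec W Skip s 1 s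
| ExecAssign s x e :
    eval s e <= W -> exec W (Assign x e) s 1 (set_reg s x (eval s e))
| ExecWrite s a o1 o2 :
    oval s o2 <= W ->
    exec W (Write a o1 o2) s 1 (set_mem s a (oval s o1) (oval s o2))
| ExecSeq p q s s1 s2 t1 t2 :
    exec W p s t1 s1 -> exec W q s1 t2 s2 ->
    exec W (Seq p q) s (t1 + t2) s2
| ExecIfTrue b p q s s1 t1 :
    holds s b -> exec W p s t1 s1 -> exec W (If b p q) s t1.+1 s1
| ExecIfFalse b p q s s1 t1 :
    ~~ holds s b -> exec W q s t1 s1 -> exec W (If b p q) s t1.+1 s1
| ExecWhileTrue b p s s1 s2 t1 t2 :
    holds s b -> exec W p s t1 s1 -> exec W (While b p) s1 t2 s2 ->
    exec W (While b p) s (t1 + t2).+1 s2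
| ExecWhileFalse b p s :
    ~~ holds s b -> exec W (While b p) s 1 s.

Lemma exec_det W p s t1 s1 t2 s2 :
  exec W p s t1 s1 -> exec W p s t2 s2 -> t1 = t2 /\ s1 = s2.
Proof.
move=> E1; elim: E1 t2 s2 => {p s t1 s1} /=.
1-3: by move=> *; match goal with H : exec _ _ _ _ _ |- _ => inversion H end.
all: move=> *; match goal with H : exec _ _ _ ?t ?s |- _ = ?t /\ _ = ?s =>
  inversion H; subst => {H} end.
all: try by match goal with
  H : is_true ?b, H' : is_true (~~ ?b) |- _ => rewrite H in H' end.
all: repeat match goal with
  IH : (forall t s, exec _ ?p ?s0 t s -> _), E : exec _ ?p ?s0 _ _ |- _ =>
    have [? ?] := IH _ _ E; clear IH E; subst end.
all: by [].
Qed.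

(** * Input and output *)

Definition adjacency_lists n (G : sgraph 'I_n) (L : 'I_n -> seq 'I_n) : Prop :=
  forall v, uniq (L v) /\ L v =i neighbours G v.

(* Array 1 holds the lists L 0, ..., L (n - 1) one after the other; the list of
   v occupies the positions from (array 0)[v] up to, not including,
   (array 0)[v + 1].  Register 0 holds n; all other cells are 0. *)
Definition initial_state n (L : 'I_n -> seq 'I_n) : state :=
  State
    (fun x => if x == 0 then n else 0)
    (fun a => match a with
     | 0 => nth 0 (mkseq (fun v => \sum_(u < n | u < v) size (L u)) n.+1)
     | 1 => nth 0 [seq val w | v <- enum 'I_n, w <- L v]
     | _ => fun=> 0
     end).

(* Register 0 holds the answer.  For yes, registers 1 and 2 hold the number of
   colours and the length of the ordering, and arrays 2, 3, 4 hold the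
   colouring, the indicator of the clique and the ordering.  For no, register 1
   holds the kind of obstruction and array 2 its vertices. *)
Definition outputs n (s : state) (w : certificate n) : Prop :=
  match w with
  | @Yes _ k c K l =>
      [/\ reg s 0 = 1,
          reg s 1 = k /\ reg s 2 = size l,
          forall v : 'I_n, mem s 2 v = c v,
          forall x : 'I_k, mem s 3 x = (x \in K) &
          forall i, i < size l -> mem s 4 i = nth 0 (map val l) i]
  | @No _ o f =>
      [/\ reg s 0 = 0, reg s 1 = obs_code o &
          forall i : 'I_(obs_size o), mem s 2 i = f i]
  end.

(* Main.v *)
From mathcomp Require Import all_boot zify.
Require Import Defs.

(** A full homomorphism can only identify vertices with equal neighbourhoods
    (twins), so G is fully threshold-colourable if and only if its quotient by
    twins is a threshold graph.  Threshold graphs are the graphs whose vertices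
    form a chain x_1, ..., x_k of the vicinal preorder: N(x_i) is contained in
    N[x_(i+1)] for all i.  Such a chain gives the clique (the vertices adjacent
    to their predecessor) and the nested independent set (the others); this is
    [vicinal_chain].  In a threshold graph, sorting by degree yields a chain.

    The algorithm computes the quotient, sorts one representative of each twin
    class by its degree in the quotient, and tests whether the result is a
    chain.  If it is, [twin_chain_certificate] makes the colouring and the chain
    a certificate.  If x precedes y and some representative w distinct from y is
    adjacent to x but not to y, a degree count ([exchange_vertex]) yields z
    adjacent to y but not to x.  The edges xw, yz and the non-edges xz, yw span a
    2K2, a P4 or a C4.  In the last case both diagonals of the C4 consist of
    vertices that are not twins, and two vertices that tell them apart lead to a
    P4 or to the complement of 2P3 ([split_C4]).  Conversely, each of the three
    obstructions is point-determining, so that a full homomorphism embeds it in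
    its target; as the complement of 2P3 contains a C4, the target is then not a
    threshold graph ([obstruction_not_colourable]).

    Time is linear because the memory is initially zero and may be addressed
    sparsely.  The adjacency matrix takes one write for each arc, after which
    adjacency tests take constant time.  Twin classes come from a trie of
    neighbourhoods, indexed by node and vertex ([refine_by_arc]), into which all
    neighbourhoods are inserted simultaneously in one pass over the lists.  The
    sorting is a bucket sort, the test reads each list at most twice, and an
    obstruction is found by a bounded number of passes over the vertices.

    The programs are verified in a Hoare logic with time bounds: [runs_wp] for
    loop-free code, [runs_for], [runs_neighbours] and [runs_vertices] for loops,
    and [exec_agree] for everything that a program leaves unchanged. *)

Set Implicit Arguments.
Unset Strict Implicit.
Unset Printing Implicit Defensive.

(** * Obstructions are point-determining *)

Definition point_determining (V : finType) (F : sgraph V) : Prop :=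
  forall x y, adj F x =1 adj F y -> x = y.

(** Two vertices that a full homomorphism identifies have the same neighbours, so
    there is nothing to identify in a point-determining graph.  Embeddings of
    the obstructions are always obtained from this: only adjacencies need to be
    checked, never distinctness. *)
Lemma full_hom_embedding (U V : finType) (F : sgraph U) (G : sgraph V) f :
  point_determining F -> full_hom F G f -> induced_embedding F G f.
Proof.
move=> pdF homf; split=> [x y eq_f | x y]; last by rewrite homf.
by apply: pdF => z; rewrite !homf eq_f.
Qed.

(** The obstructions as decidable relations on natural numbers: the ordinals and
    the case analysis on [split] in their definitions do not compute, whereas
    these do. *)
Definition obs_rel (o : obstruction) : rel nat :=
  match o with
  | Obs2K2 => fun i j => (i != j) && ((i < 2) == (j < 2))
  | ObsP4 => fun i j => (i.+1 == j) || (j.+1 == i)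
  | ObsCo2P3 => fun i j =>
      (i != j) &&
      ~~ (((i < 3) == (j < 3)) && ((i.+1 == j) || (j.+1 == i)))
  end.

Lemma obs_relE o (i j : 'I_(obs_size o)) :
  adj (obs_graph o) i j = obs_rel o i j.
Proof.
case: o i j => //= i j; rewrite ?/compl_adj /= /union_adj -?val_eqE;
  case: splitP => a ia; case: splitP => b jb;
  rewrite /= ?/path_adj -?val_eqE /= ?ia ?jb; lia.
Qed.

Lemma obs_graph_point_determining o : point_determining (obs_graph o).
Proof.
move=> x y eq_xy; apply/val_inj/eqP.
have comp : all (fun i => all (fun j => (i == j) ||
    has (fun z => obs_rel o i z != obs_rel o j z) (iota 0 (obs_size o)))
    (iota 0 (obs_size o))) (iota 0 (obs_size o)) by case: (o).
have in_iota (i : 'I_(obs_size o)) : val i \in iota 0 (obs_size o).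
  by rewrite mem_iota /= add0n.
have /orP[//|/hasP[z]] := allP (allP comp _ (in_iota x)) _ (in_iota y).
rewrite mem_iota add0n /= => z_lt.
by have := eq_xy (Ordinal z_lt); rewrite !obs_relE /= => ->; rewrite eqxx.
Qed.

(** * Chains of the vicinal preorder *)

(** The vicinal preorder of Foldes and Hammer: N(x) is contained in N[y]. *)
Definition vicinal_le (V : finType) (H : sgraph V) : rel V :=
  fun x y => [forall w, adj H x w && (w != y) ==> adj H y w].

Section VicinalChain.

Variables (V : finType) (H : sgraph V).

Lemma vicinal_leP x y :
  reflect (forall w, adj H x w -> w != y -> adj H y w) (vicinal_le H x y).
Proof.
apply: (iffP forallP) => le_xy w => [xw wNy|].
  by apply: (implyP (le_xy w)); rewrite xw.
by apply/implyP=> /andP[]; apply: le_xy.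
Qed.

Lemma vicinal_le_refl : reflexive (vicinal_le H).
Proof. by move=> x; apply/vicinal_leP. Qed.

Lemma vicinal_le_trans : transitive (vicinal_le H).
Proof.
move=> y x z /vicinal_leP le_xy /vicinal_leP le_yz; apply/vicinal_leP.
move=> w xw wz.
have [wy | wNy] := eqVneq w y; last exact: le_yz (le_xy _ xw wNy) wz.
have [<- // | xNz] := eqVneq x z.
have zx : adj H z x by apply: le_yz => //; rewrite adj_sym -wy.
rewrite adj_sym wy; apply: le_xy; first by rewrite adj_sym.
by rewrite -wy eq_sym.
Qed.

(** In each of 2K2, P4 and C4 one finds edges xw and yz such that xz and yw are
    non-edges.  Then w shows that x is not below y, and z that y is not below
    x. *)
Lemma vicinal_total_threshold : total (vicinal_le H) -> threshold H.
Proof.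
move=> tot.
have no_switch x w y z : adj H x w -> ~~ adj H y w -> w != y ->
    adj H y z -> ~~ adj H x z -> z = x.
  move=> xw yNw wNy yz xNz; apply/eqP; apply: contraT => zNx.
  case/orP: (tot x y) => /vicinal_leP le.
    by rewrite le in yNw.
  by rewrite le in xNz.
split.
- case=> f [inj_f adj_f].
  have := @no_switch (f (@Ordinal 4 0 isT)) (f (@Ordinal 4 1 isT))
                    (f (@Ordinal 4 2 isT)) (f (@Ordinal 4 3 isT)).
  rewrite !adj_f !(@obs_relE Obs2K2) (inj_eq inj_f) => /(_ isT isT isT isT isT).
  by move/inj_f.
- case=> f [inj_f adj_f].
  have := @no_switch (f (@Ordinal 4 1 isT)) (f (@Ordinal 4 0 isT))
                    (f (@Ordinal 4 2 isT)) (f (@Ordinal 4 3 isT)).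
  rewrite !adj_f (inj_eq inj_f) => /(_ isT isT isT isT isT).
  by move/inj_f.
- case=> f [inj_f adj_f].
  have := @no_switch (f (@Ordinal 4 0 isT)) (f (@Ordinal 4 1 isT))
                    (f (@Ordinal 4 3 isT)) (f (@Ordinal 4 2 isT)).
  rewrite !adj_f (inj_eq inj_f) => /(_ isT isT isT isT isT).
  by move/inj_f.
Qed.

Variables (x0 : V) (o : seq V).
Hypotheses (uniq_o : uniq o) (mem_o : o =i [set: V]).
Hypothesis chain_o :
  forall i, i < size o -> vicinal_le H (nth x0 o i.-1) (nth x0 o i).

(** At i = 0 the predecessor [0.-1] is the vertex itself, so the first vertex of a
    chain always goes to the independent side. *)
Definition starts_independent i := ~~ adj H (nth x0 o i.-1) (nth x0 o i).

Definition independent_side : seq V :=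
  [seq nth x0 o i | i <- iota 0 (size o) & starts_independent i].

Let chain_le i j : i <= j < size o -> vicinal_le H (nth x0 o i) (nth x0 o j).
Proof.
case/andP=> le_ij lt_jo; rewrite -(subnKC le_ij) in lt_jo *.
elim: (j - i) lt_jo => [|d IHd] lt_jo; first by rewrite addn0 vicinal_le_refl.
rewrite addnS in lt_jo *.
exact: vicinal_le_trans (IHd (ltnW lt_jo)) (chain_o lt_jo).
Qed.

Let chain_adj i j w : i <= j < size o ->
  adj H (nth x0 o i) w -> w != nth x0 o j -> adj H (nth x0 o j) w.
Proof. by move/chain_le/vicinal_leP; apply. Qed.

Let nth_neq i j : i < j < size o -> nth x0 o i != nth x0 o j.
Proof.
case/andP=> lt_ij lt_j; rewrite nth_uniq //; first by rewrite neq_ltn lt_ij.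
exact: ltn_trans lt_j.
Qed.

Let in_o x : exists2 i, i < size o & nth x0 o i = x.
Proof.
have o_x : x \in o by rewrite mem_o inE.
by exists (index x o); rewrite ?index_mem ?nth_index.
Qed.

Let mem_side i : i < size o ->
  (nth x0 o i \in independent_side) = starts_independent i.
Proof.
move=> lt_i; apply/mapP/idP => [[j] | ind].
  rewrite mem_filter mem_iota add0n => /and3P[ind _ lt_j] /eqP.
  by rewrite nth_uniq // => /eqP->.
by exists i; rewrite // mem_filter ind mem_iota add0n.
Qed.

Lemma vicinal_chain_threshold : threshold H.
Proof.
apply: vicinal_total_threshold => x y.
have [i lt_i <-] := in_o x; have [j lt_j <-] := in_o y.
case/orP: (leq_total i j) => le_ij; last rewrite orbC.
  by rewrite chain_le ?le_ij.
by rewrite chain_le ?le_ij.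
Qed.

(** An edge from i to j, with i < j, yields an edge from j - 1 to j, because
    N(i) is contained in N[j - 1]. *)
Let adj_up i j : i < j < size o ->
  adj H (nth x0 o i) (nth x0 o j) -> ~~ starts_independent j.
Proof.
case/andP=> lt_ij lt_j ij; rewrite negbK; case: j lt_ij lt_j ij => //= j.
rewrite ltnS leq_eqVlt => /predU1P[-> // | lt_ij] lt_j ij.
apply: (@chain_adj i); rewrite ?(ltnW lt_ij) ?(ltnW lt_j) //.
by rewrite eq_sym nth_neq ?ltnSn.
Qed.

Lemma vicinal_chain_certificate :
  threshold_certificate H (~: [set x in independent_side])
    [set x in independent_side] independent_side.
Proof.
have indep : independent H [set x in independent_side].
  move=> x y; have [i lt_i <-] := in_o x; have [j lt_j <-] := in_o y.
  wlog lt_ij : i j lt_i lt_j / i < j => [wlog_ij|].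
    case: (ltngtP i j) => [lt_ij | lt_ji | -> _ _]; last by rewrite adj_irr.
      exact: wlog_ij.
    by move=> Ix Iy; rewrite adj_sym; apply: wlog_ij.
  rewrite !inE !mem_side // => _; apply: contraL; apply: adj_up.
  by rewrite lt_ij.
split=> //.
- by rewrite setUC setUCr disjoints_subset subxx.
(* For i < j, both adjacent to their predecessors: the edge from i - 1 to i
   gives one from i - 1 to j, since N(i) is contained in N[j]; this gives one
   from i to j, since N(i - 1) is contained in N[i]. *)
- move=> x y; have [i lt_i <-] := in_o x; have [j lt_j <-] := in_o y.
  wlog lt_ij : i j lt_i lt_j / i < j => [wlog_ij|].
    case: (ltngtP i j) => [lt_ij | lt_ji | -> _ _]; last by rewrite eqxx.
      exact: wlog_ij.
    by move=> Ix Iy; rewrite adj_sym eq_sym; apply: wlog_ij.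
  rewrite !inE !mem_side // !negbK => adj_i _ _.
  have lt_i1 : i.-1 < i by case: i adj_i {lt_i lt_ij} => //=; rewrite adj_irr.
  have lt_i1j := ltn_trans lt_i1 lt_ij.
  apply: (@chain_adj i.-1); rewrite ?(ltnW lt_i1) ?lt_i //.
    rewrite adj_sym; apply: (@chain_adj i); rewrite ?(ltnW lt_ij) ?lt_j //.
      by rewrite adj_sym.
    by rewrite nth_neq ?lt_i1j.
  by rewrite eq_sym nth_neq ?lt_ij.
- split=> [|x|].
  + rewrite map_inj_in_uniq ?filter_uniq ?iota_uniq // => i j.
    rewrite !mem_filter !mem_iota !add0n => /and3P[_ _ li] /and3P[_ _ lj] /eqP.
    by rewrite nth_uniq // => /eqP.
  + by rewrite inE.
  have le_I x y : x \in [set x in independent_side] -> 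
     y \in [set x in independent_side] -> vicinal_le H x y ->
      neighbours H x :\: [set x in independent_side]
      \subset neighbours H y :\: [set x in independent_side].
    move=> Ix Iy /vicinal_leP le_xy; apply/subsetP=> w; rewrite !inE.
    case/andP=> wI xw; rewrite wI /= le_xy //; apply: contraNneq wI => ->.
    by rewrite inE in Iy.
  apply: (@homo_sorted_in _ _ [pred i | (i < size o) && starts_independent i]
            (nth x0 o) ltn).
  + move=> i j /andP[lt_i Ii] /andP[lt_j Ij] /= lt_ij.
    by apply: le_I; rewrite ?inE ?mem_side // chain_le ?(ltnW lt_ij).
  + by apply/allP=> i; rewrite mem_filter mem_iota /= andbC add0n.
  by rewrite sorted_filter ?iota_ltn_sorted //; apply: ltn_trans.
Qed.
End VicinalChain.

(** * Finding obstructions *)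

(** In the complement of 2P3, a non-adjacent pair from each of the two paths
    spans a 4-cycle. *)
Lemma C4_in_co_two_P3 : has_induced C4 co_two_P3.
Proof.
pose f (i : 'I_4) : 'I_6 := inord (nth 0 [:: 0; 3; 1; 4] i).
have val_f i : f i = nth 0 [:: 0; 3; 1; 4] i :> nat.
  by rewrite inordK //; case: i => [[|[|[|[|]]]]].
exists f; split=> [i j /(congr1 (@nat_of_ord _)) | i j].
  rewrite !val_f => eq_ij; apply/val_inj; move: eq_ij.
  by case: i j => [[|[|[|[|//]]]] ?] [[|[|[|[|//]]]] ?].
rewrite (@obs_relE ObsCo2P3) !val_f.
by case: i j => [[|[|[|[|//]]]] ?] [[|[|[|[|//]]]] ?].
Qed.

Lemma has_induced_trans (T U V : finType) (F : sgraph T) (G : sgraph U)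
    (H : sgraph V) : has_induced F G -> has_induced G H -> has_induced F H.
Proof.
case=> f [inj_f adj_f] [g [inj_g adj_g]]; exists (g \o f).
by split=> [|x y]; [apply: inj_comp | rewrite adj_g adj_f].
Qed.

(** A full homomorphism carries a point-determining obstruction to an induced
    copy in the threshold graph; 2K2 and P4 are forbidden there, and the
    complement of 2P3 contains the forbidden C4. *)
Lemma obstruction_not_colourable (V : finType) (G : sgraph V) o :
  has_induced (obs_graph o) G -> ~ fully_threshold_colourable G.
Proof.
case=> f [inj_f adj_f] [W [H [h [thrH hom_h]]]].
have emb : has_induced (obs_graph o) H.
  exists (h \o f); apply: full_hom_embedding => [|x y].
    exact: obs_graph_point_determining.
  by rewrite -adj_f hom_h.
case: o f emb {inj_f adj_f} thrH => f emb [] //.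
by move=> _ _; apply; apply: has_induced_trans emb; apply: C4_in_co_two_P3.
Qed.

Lemma pattern_embedding (V : finType) (G : sgraph V) o x0 (s : seq V) :
  (forall i j, i < j < obs_size o ->
    adj G (nth x0 s i) (nth x0 s j) = obs_rel o i j) ->
  induced_embedding (obs_graph o) G (fun i => nth x0 s i).
Proof.
move=> adj_s; apply: full_hom_embedding => [|i j].
  exact: obs_graph_point_determining.
have sym_o : obs_rel o i j = obs_rel o j i by rewrite -!obs_relE adj_sym.
rewrite obs_relE; case: (ltngtP i j) => [lt_ij | lt_ji | eq_ij].
- by rewrite adj_s // lt_ij ltn_ord.
- by rewrite sym_o adj_sym adj_s // lt_ji ltn_ord.
by rewrite eq_ij adj_irr -obs_relE adj_irr.
Qed.

Section Obstructions.

Variables (V : finType) (G : sgraph V) (x0 : V).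

Lemma two_K2_embedding x w y z :
    adj G x w -> adj G y z ->
    ~~ adj G x y -> ~~ adj G x z -> ~~ adj G w y -> ~~ adj G w z ->
  induced_embedding two_K2 G (fun i => nth x0 [:: x; w; y; z] i).
Proof.
move=> xw yz xy xz wy wz; apply: (@pattern_embedding _ _ Obs2K2) => i j /andP[].
case: i j => [|[|[|[|i]]]] [|[|[|[|j]]]] //= _ _;
  by rewrite ?xw ?yz ?(negPf xy) ?(negPf xz) ?(negPf wy) ?(negPf wz).
Qed.

Lemma P4_embedding a b c d :
    adj G a b -> adj G b c -> adj G c d ->
    ~~ adj G a c -> ~~ adj G a d -> ~~ adj G b d ->
  induced_embedding P4 G (fun i => nth x0 [:: a; b; c; d] i).
Proof.
move=> ab bc cd ac ad bd; apply: (@pattern_embedding _ _ ObsP4) => i j /andP[].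
case: i j => [|[|[|[|i]]]] [|[|[|[|j]]]] //= _ _;
  by rewrite ?ab ?bc ?cd ?(negPf ac) ?(negPf ad) ?(negPf bd).
Qed.

Lemma co_two_P3_embedding a b c d e f :
    ~~ adj G a b -> ~~ adj G b c -> adj G a c ->
    ~~ adj G d e -> ~~ adj G e f -> adj G d f ->
    (forall u v, u \in [:: a; b; c] -> v \in [:: d; e; f] -> adj G u v) ->
  induced_embedding co_two_P3 G (fun i => nth x0 [:: a; b; c; d; e; f] i).
Proof.
move=> ab bc ac de ef df cross.
apply: (@pattern_embedding _ _ ObsCo2P3) => i j /andP[].
case: i j => [|[|[|[|[|[|i]]]]]] [|[|[|[|[|[|j]]]]]] //= _ _;
  by rewrite ?(negPf ab) ?(negPf bc) ?ac ?(negPf de) ?(negPf ef) ?df //=;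
     apply: cross; rewrite !inE eqxx ?orbT.
Qed.

(** A degree count: if x has at most as many neighbours as y in R, and w is a
    neighbour of x that y lacks, then some z is a neighbour of y that x lacks.
    Degrees are counted in R because the vertices of R stand for the twin
    classes, while degrees in the whole graph also depend on the sizes of the
    classes and do not order a threshold graph along its chain. *)
Lemma exchange_vertex (R : {pred V})
    (deg := fun v => #|[pred w in R | adj G v w]|) x y w :
    x \in R -> y \in R -> w \in R -> deg x <= deg y ->
    adj G x w -> w != y -> ~~ adj G y w ->
  exists z, [/\ z \in R, z != x, adj G y z & ~~ adj G x z].
Proof.
move=> Rx Ry Rw le_deg xw wNy yw.
case: (pickP [pred z in R | [&& z != x, adj G y z & ~~ adj G x z]]).
  by move=> z /and4P[]; exists z.
move=> none; suff: deg y < deg x by rewrite ltnNge le_deg.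
(* If there is no such z, exchanging x and y maps the neighbours of y in R
   injectively to neighbours of x other than w. *)
pose swap v := if v == x then y else v.
have inj_swap : {in [pred z in R | adj G y z] &, injective swap}.
  move=> u v; rewrite !inE /swap => /andP[_ yu] /andP[_ yv].
  case: eqP => [-> | _]; case: eqP => [-> // | _] // eq_uv.
    by rewrite -eq_uv adj_irr in yv.
  by rewrite eq_uv adj_irr in yu.
rewrite /deg -(card_in_image inj_swap); apply: proper_card.
apply/properP; split.
  apply/subsetP=> _ /imageP[v /andP[/= Rv yv] ->]; rewrite inE /swap.
  case: eqP yv => [-> | /eqP vNx] yv; first by rewrite Ry adj_sym.
  by rewrite Rv; have := none v; rewrite /= Rv vNx yv /= => /negbFE.
exists w; first by rewrite inE Rw.
apply/negP=> /imageP[v /andP[/= Rv yv]]; rewrite /swap.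
case: eqP => [_ /eqP | _ eq_wv]; first exact/negP.
by rewrite eq_wv yv in yw.
Qed.

End Obstructions.

(** * Certificates from chains *)

(** The pairs of a term and its predecessor, the first term being its own
    predecessor.  This form needs no default element, so that it also makes
    sense for the graph without vertices. *)
Definition consecutive (T : Type) (o : seq T) : seq (T * T) :=
  zip (take 1 o ++ o) o.

Lemma size_consecutive T (o : seq T) : size (consecutive o) = size o.
Proof. by rewrite size_zip size_cat; apply/minn_idPr; apply: leq_addl. Qed.

Lemma consecutiveE (T : Type) (x0 : T) o :
  consecutive o = [seq (nth x0 o i.-1, nth x0 o i) | i <- iota 0 (size o)].
Proof.
apply: (@eq_from_nth _ (x0, x0)) => [|i lt_i].
  by rewrite size_map size_iota size_consecutive.
rewrite size_consecutive in lt_i.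
rewrite (nth_map 0) ?size_iota // nth_iota // add0n.
rewrite nth_zip_cond -/(consecutive o) size_consecutive lt_i; congr (_, _).
by case: o lt_i => // x o _; case: i => //= i; rewrite take0.
Qed.

Lemma consecutive_map S T (f : S -> T) o :
  consecutive (map f o) = [seq (f p.1, f p.2) | p <- consecutive o].
Proof.
rewrite /consecutive -map_take -map_cat.
by elim: o (take 1 o ++ o) => [|y o IHo] [|x s] //=; rewrite IHo.
Qed.

Lemma map_snd_consecutive T (o : seq T) : [seq p.2 | p <- consecutive o] = o.
Proof.
rewrite -[RHS](@unzip2_zip _ _ (take 1 o ++ o) o) // size_cat.
exact: leq_addl.
Qed.

Lemma vicinal_chain (V : finType) (H : sgraph V) (o : seq V)
    (I := [seq p.2 | p <- consecutive o & ~~ adj H p.1 p.2]) :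
  uniq o -> o =i [set: V] ->
  {in consecutive o, forall p, vicinal_le H p.1 p.2} ->
  threshold H /\ threshold_certificate H (~: [set x in I]) [set x in I] I.
Proof.
move=> uniq_o mem_o chain.
case: (pickP [pred x : V | true]) => [x0 _ | noV]; last first.
  have o0 : o = [::] by case: (o) => // x; have := noV x.
  have I0 : I = [::] by rewrite /I o0.
  rewrite I0; split; first by apply: vicinal_total_threshold => x; have := noV x.
  split=> [|x|x|].
  - by rewrite setUC setUCr disjoints_subset subxx.
  - by have := noV x.
  - by have := noV x.
  by split=> // x; have := noV x.
have chain_o i : i < size o -> vicinal_le H (nth x0 o i.-1) (nth x0 o i).
  move=> lt_i; apply: (chain (nth x0 o i.-1, nth x0 o i)).
  by rewrite (consecutiveE x0) map_f // mem_iota.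
have -> : I = independent_side H x0 o.
  by rewrite /I (consecutiveE x0) filter_map -map_comp.
split; first exact: vicinal_chain_threshold chain_o.
exact: vicinal_chain_certificate chain_o.
Qed.

(** The colours are the classes of vertices with equal neighbourhoods, and R is
    a transversal of these classes.  The algorithm computes both. *)
Definition twin_colouring (V : finType) (G : sgraph V) k (c : V -> 'I_k)
    (R : {set V}) : Prop :=
  [/\ forall u v, c u = c v <-> adj G u =1 adj G v,
      forall x, exists2 v, v \in R & c v = x &
      {in R &, injective c}].

Section TwinColouring.

Variables (V : finType) (G : sgraph V) (k : nat) (c : V -> 'I_k).
Variable R : {set V}.
Hypothesis colouring : twin_colouring G c R.

Definition colour_adj (a b : 'I_k) : bool :=
  [exists u, exists v, [&& c u == a, c v == b & adj G u v]].

Lemma colour_adj_hom u v : adj G u v = colour_adj (c u) (c v).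
Proof.
have [twins _ _] := colouring.
apply/idP/existsP=> [uv | [u' /existsP[v' /and3P[/eqP cu /eqP cv uv]]]].
  by exists u; apply/existsP; exists v; rewrite !eqxx.
have [/(_ cu) eq_u _] := twins u' u; have [/(_ cv) eq_v _] := twins v' v.
by rewrite -eq_u adj_sym -eq_v adj_sym.
Qed.

Lemma colour_adj_sym : symmetric colour_adj.
Proof.
have [_ onto _] := colouring => a b.
have [u _ <-] := onto a; have [v _ <-] := onto b.
by rewrite -!colour_adj_hom adj_sym.
Qed.

Lemma colour_adj_irr : irreflexive colour_adj.
Proof.
have [_ onto _] := colouring => a.
by have [u _ <-] := onto a; rewrite -colour_adj_hom adj_irr.
Qed.

Definition colour_graph : sgraph 'I_k := SGraph colour_adj_sym colour_adj_irr.

(** Domination only has to be tested on representatives, and only against other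
    representatives.  The side condition compares vertices instead of colours,
    which is enough because the vertices are representatives. *)
Lemma colour_vicinal_le x y :
  (forall w, w \in R -> adj G x w -> w != y -> adj G y w) ->
  vicinal_le colour_graph (c x) (c y).
Proof.
have [_ onto _] := colouring => le_xy; apply/vicinal_leP=> a.
have [w Rw <-] := onto a; rewrite /= -!colour_adj_hom => xw cwNcy.
by apply: le_xy => //; apply: contraNneq cwNcy => ->.
Qed.

End TwinColouring.

(** Representatives in an order in which each one is dominated by the next yield
    a valid certificate of the answer yes: the colour classes form the quotient
    by twins, in which the order is a chain of the vicinal preorder. *)
Lemma twin_chain_certificate n (G : sgraph 'I_n) k (c : 'I_n -> 'I_k) R o
    (I := [seq c p.2 | p <- consecutive o & ~~ adj G p.1 p.2]) :
  twin_colouring G c R -> uniq o -> o =i R ->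
  {in consecutive o, forall p w,
    w \in R -> adj G p.1 w -> w != p.2 -> adj G p.2 w} ->
  valid_certificate G (Yes c (~: [set x in I]) I).
Proof.
move=> col uniq_o mem_o chain; have [_ onto inj_c] := col.
pose H := colour_graph col.
have chain_c : {in consecutive (map c o), forall p, vicinal_le H p.1 p.2}.
  rewrite consecutive_map => _ /mapP[p o_p ->] /=.
  by apply: colour_vicinal_le; apply: chain.
have I_c : I = [seq p.2 | p <- consecutive (map c o) & ~~ adj H p.1 p.2].
  rewrite consecutive_map filter_map -map_comp /I; congr map.
  by apply: eq_filter => p /=; rewrite -(colour_adj_hom col).
have [||thr cert] := vicinal_chain _ _ chain_c.
- rewrite map_inj_in_uniq // => x y; rewrite !mem_o; exact: inj_c.
- move=> a; rewrite inE; have [v Rv <-] := onto a.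
  by rewrite map_f // mem_o.
exists H; split=> //; first by move=> u v; apply: (colour_adj_hom col).
  by move=> x; have [v _ <-] := onto x; exists v.
by rewrite setCK I_c.
Qed.

Lemma yes_certificate_colourable n (G : sgraph 'I_n) w :
  valid_certificate G w -> is_yes w -> fully_threshold_colourable G.
Proof. by case: w => // k c K s [H [hom _ thr _]] _; exists 'I_k, H, c. Qed.

Lemma valid_certificate_answer n (G : sgraph 'I_n) w :
  valid_certificate G w -> is_yes w <-> fully_threshold_colourable G.
Proof.
move=> valid; split; first exact: yes_certificate_colourable.
case: w valid => // o f emb /= col.
by case: (@obstruction_not_colourable _ G o _ col); exists f.
Qed.

(** * Reasoning about programs *)

(** Total correctness with a time bound.  As in [exec], no value above W may be
    written, so every assignment comes with a proof obligation. *)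
Definition runs W p s t (Q : state -> Prop) : Prop :=
  exists t' s', [/\ exec W p s t' s', t' <= t & Q s'].

(** Framing is syntactic: a program leaves alone every register and array that
    it does not mention as a target.  Hence specifications only speak of what
    a program changes, and the rest is recovered by [exec_agree]. *)
Fixpoint wregs (p : cmd) : seq nat :=
  match p with
  | Skip | Write _ _ _ => [::]
  | Assign x _ => [:: x]
  | Seq p q | If _ p q => wregs p ++ wregs q
  | While _ p => wregs p
  end.

Fixpoint warrs (p : cmd) : seq nat :=
  match p with
  | Skip | Assign _ _ => [::]
  | Write a _ _ => [:: a]
  | Seq p q | If _ p q => warrs p ++ warrs q
  | While _ p => warrs p
  end.

Definition agree (rs ars : seq nat) (s s' : state) : Prop :=
  (forall x, x \notin rs -> reg s' x = reg s x) /\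
  (forall a i, a \notin ars -> mem s' a i = mem s a i).

Lemma agree_trans rs ars s1 s2 s3 :
  agree rs ars s1 s2 -> agree rs ars s2 s3 -> agree rs ars s1 s3.
Proof.
case=> r12 a12 [r23 a23].
by split=> [x xN | a i aN]; rewrite ?r23 ?a23 // ?r12 ?a12.
Qed.

Lemma agree_sub rs ars rs' ars' s s' :
  {subset rs <= rs'} -> {subset ars <= ars'} ->
  agree rs ars s s' -> agree rs' ars' s s'.
Proof.
move=> sub_r sub_a [eq_r eq_a].
split=> [x xN | a i aN]; first by apply/eq_r/(contra (@sub_r x)).
by apply/eq_a/(contra (@sub_a a)).
Qed.

Lemma exec_agree W p s t s' :
  exec W p s t s' -> agree (wregs p) (warrs p) s s'.
Proof.
elim=> {p s t s'} //=.
- move=> s x e _; split=> //= y; by rewrite inE => /negPf->.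
- move=> s a o1 o2 _; split=> //= b i; by rewrite inE => /negPf->.
- move=> p q s s1 s2 t1 t2 _ ag1 _ ag2; apply: agree_trans.
    by apply: agree_sub ag1 => x; rewrite mem_cat => ->.
  by apply: agree_sub ag2 => x; rewrite mem_cat orbC => ->.
- move=> b p q s s1 t _ _; apply: agree_sub => x; by rewrite mem_cat => ->.
- move=> b p q s s1 t _ _; apply: agree_sub => x; by rewrite mem_cat orbC => ->.
by move=> b p s s1 s2 t1 t2 _ _ ag1 _; apply: agree_trans.
Qed.

Lemma runs_weaken W p s t t' (Q Q' : state -> Prop) :
  runs W p s t Q -> t <= t' ->
  (forall s', agree (wregs p) (warrs p) s s' -> Q s' -> Q' s') ->
  runs W p s t' Q'.
Proof.
move=> [t1 [s1 [ex le_t Qs]]] le_t' QQ'; exists t1, s1; split=> //.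
  exact: leq_trans le_t'.
by apply: QQ' => //; apply: exec_agree ex.
Qed.

Lemma runs_seq W p q s t1 t2 R Q :
  runs W p s t1 R ->
  (forall s', agree (wregs p) (warrs p) s s' -> R s' -> runs W q s' t2 Q) ->
  runs W (Seq p q) s (t1 + t2) Q.
Proof.
move=> [t1' [s1 [ex1 le1 Rs]]] /(_ _ (exec_agree ex1) Rs).
move=> [t2' [s2 [ex2 le2 Qs]]]; exists (t1' + t2'), s2.
by split=> //; [apply: ExecSeq ex1 ex2 | apply: leq_add].
Qed.

Lemma runs_if W b p q s t Q :
  (holds s b -> runs W p s t Q) -> (~~ holds s b -> runs W q s t Q) ->
  runs W (If b p q) s t.+1 Q.
Proof.
case: (boolP (holds s b)) => [bT /(_ isT) + _ | bF _ /(_ isT)];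
  move=> [t' [s' [ex le_t Qs]]]; exists t'.+1, s'; split=> //.
  exact: ExecIfTrue.
exact: ExecIfFalse.
Qed.

(** Weakest preconditions of loop-free programs.  On a concrete program this
    evaluates to a conjunction of word-size obligations followed by the
    postcondition of an explicit final state. *)
Fixpoint wp W (p : cmd) (s : state) (Q : state -> Prop) : Prop :=
  match p with
  | Skip => Q s
  | Assign x e => eval s e <= W /\ Q (set_reg s x (eval s e))
  | Write a o1 o2 => oval s o2 <= W /\ Q (set_mem s a (oval s o1) (oval s o2))
  | Seq p q => wp W p s (fun s' => wp W q s' Q)
  | If b p q => if holds s b then wp W p s Q else wp W q s Q
  | While _ _ => False
  end.

Fixpoint cost (p : cmd) : nat :=
  match p with
  | Skip | Assign _ _ | Write _ _ _ => 1
  | Seq p q => cost p + cost q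
  | If _ p q => (maxn (cost p) (cost q)).+1
  | While _ _ => 0
  end.

Lemma runs_wp W p s (Q : state -> Prop) : wp W p s Q -> runs W p s (cost p) Q.
Proof.
elim: p s Q => //=.
- by move=> s Q Qs; exists 1, s; split=> //; apply: ExecSkip.
- move=> x e s Q [leW Qs]; exists 1, (set_reg s x (eval s e)).
  by split=> //; apply: ExecAssign.
- move=> a o1 o2 s Q [leW Qs].
  exists 1, (set_mem s a (oval s o1) (oval s o2)).
  by split=> //; apply: ExecWrite.
- move=> p IHp q IHq s Q /IHp wp_p; apply: runs_seq wp_p _ => s' _.
  exact: IHq.
move=> b p IHp q IHq s Q wp_if; apply: runs_if => [bT | /negPf bF].
  move: wp_if; rewrite bT => /IHp/runs_weaken; apply=> //; exact: leq_maxl.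
move: wp_if; rewrite bF => /IHq/runs_weaken; apply=> //; exact: leq_maxr.
Qed.

Definition For i lo hi p :=
  Seq (Assign i (Val lo))
    (While (Lt (Reg i) hi) (Seq p (Assign i (Add (Reg i) (Imm 1))))).

Definition reads_only (o : operand) (rs : seq nat) : bool :=
  if o is Reg x then x \notin rs else true.

Lemma agree_oval rs ars s s' o :
  agree rs ars s s' -> reads_only o rs -> oval s' o = oval s o.
Proof. by case: o => [//|x] [eq_r _] /= /eq_r. Qed.

(** In the body the invariant speaks of the state before the counter is
    increased, while the conclusion of an iteration speaks of the state after
    it, hence the [set_reg].  The 2 in the sum pays for the test and for the
    increment. *)
Lemma runs_for W i lo hi p s (T : nat -> nat) (Inv : nat -> state -> Prop) :
  i \notin wregs p -> reads_only hi (i :: wregs p) ->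
  oval s lo <= oval s hi -> oval s hi <= W ->
  Inv (oval s lo) (set_reg s i (oval s lo)) ->
  (forall k s1, oval s lo <= k < oval s hi ->
     agree (i :: wregs p) (warrs p) s s1 -> reg s1 i = k -> Inv k s1 ->
     runs W p s1 (T k) (fun s2 => Inv k.+1 (set_reg s2 i k.+1))) ->
  runs W (For i lo hi p) s
    (2 + \sum_(oval s lo <= k < oval s hi) (T k + 2)) (Inv (oval s hi)).
Proof.
move=> iNp hiN; set a := oval s lo; set b := oval s hi => le_ab le_bW Inv_a.
move=> step.
rewrite /For; set body := Seq p _; set loop := While _ body.
have loop_runs k s1 : a <= k <= b -> agree (i :: wregs p) (warrs p) s s1 ->
    reg s1 i = k -> Inv k s1 ->
    runs W loop s1 (1 + \sum_(k <= j < b) (T j + 2)) (Inv b).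
  move: {2}(b - k) (erefl (b - k)) => d.
  elim: d k s1 => [|d IHd] k s1 def_d /andP[le_ak le_kb] ag s1_i Inv_k.
    have eq_kb: k = b by apply/eqP; rewrite eqn_leq le_kb -subn_eq0 def_d.
    exists 1, s1; rewrite -eq_kb; split=> //; apply: ExecWhileFalse.
    by rewrite /= (agree_oval ag) // s1_i eq_kb ltnn.
  have lt_kb : k < b by rewrite -subn_gt0 def_d.
  have kab: a <= k < b by rewrite le_ak.
  have [t2 [s2 [ex2 le_t2 Inv2]]] := step k s1 kab ag s1_i Inv_k.
  have s2_i : reg s2 i = k by rewrite (proj1 (exec_agree ex2)).
  have ex2' : exec W body s1 (t2 + 1) (set_reg s2 i k.+1).
    have -> : k.+1 = eval s2 (Add (Reg i) (Imm 1)) by rewrite /= s2_i addn1.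
    apply/(ExecSeq ex2)/ExecAssign; rewrite /= s2_i addn1.
    exact: leq_trans le_bW.
  have [|||||t3 [s3 [ex3 le_t3 Inv3]]] := IHd k.+1 (set_reg s2 i k.+1).
  - by rewrite subnS def_d.
  - by rewrite (leq_trans le_ak) /=.
  - apply: agree_trans ag _; apply: agree_sub (exec_agree ex2') => //= x.
      by rewrite mem_cat !inE orbC.
    by rewrite cats0.
  - by rewrite /= eqxx.
  - exact: Inv2.
  exists (t2 + 1 + t3).+1, s3; split=> //.
    by apply: ExecWhileTrue ex2' ex3; rewrite /= (agree_oval ag) // s1_i.
  by rewrite big_ltn //; lia.
rewrite addSn -add1n.
apply: (@runs_seq _ _ _ _ _ _ (fun s1 => s1 = set_reg s i a)).
  exists 1, (set_reg s i a); split=> //; apply: ExecAssign.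
  exact: leq_trans le_bW.
move=> s1 _ ->; apply: loop_runs => //; last by rewrite /= eqxx.
  by rewrite leqnn.
by split=> //= x; rewrite inE negb_or => /andP[/negPf->].
Qed.

(** * Traversing the adjacency lists *)

(** The handshake lemma, as an inequality: an edge has at most two
    orientations. *)
Lemma sum_degrees n (G : sgraph 'I_n) L : adjacency_lists G L ->
  \sum_(v < n) size (L v) <= 2 * #|edges G|.
Proof.
move=> adjL; pose arcs := [pred p : 'I_n * 'I_n | adj G p.1 p.2].
pose ends (p : 'I_n * 'I_n) := [set p.1; p.2].
have -> : \sum_(v < n) size (L v) = #|arcs|.
  rewrite -sum1_card (eq_bigl (fun p => adj G p.1 p.2)) //.
  rewrite -(pair_big_dep xpredT (fun v w => adj G v w) (fun _ _ => 1)) /=.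
  apply: eq_bigr => v _; rewrite sum1_card; have [uL memL] := adjL v.
  rewrite -(card_uniqP uL); apply: eq_card => w.
  by rewrite memL inE.
rewrite -(sum1_card arcs) (partition_big ends (fun e => e \in edges G))
  => [|p arc_p].
  rewrite mulnC -sum_nat_const; apply: leq_sum => e; rewrite inE.
  case/existsP=> a /existsP[b /andP[ab /eqP->]]; rewrite sum1_card.
  apply: leq_trans (_ : #|[set (a, b); (b, a)]| <= 2); last first.
    by rewrite cards2; case: (_ != _).
  apply/subset_leq_card/subsetP=> [[u v]]; rewrite unfold_in /= => /andP[uv].
  move=> /eqP eq_e; rewrite !inE /=.
  have {}uv : adj G u v by [].
  have uNv : u != v by apply: contraTneq uv => ->; rewrite adj_irr.
  have : u \in [set a; b] by rewrite -eq_e !inE eqxx.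
  have : v \in [set a; b] by rewrite -eq_e !inE eqxx orbT.
  rewrite !inE !xpair_eqE => /orP[] /eqP eq_v /orP[] /eqP eq_u;
    by move: uNv; rewrite eq_u eq_v !eqxx ?orbT.
rewrite inE; apply/existsP; exists p.1; apply/existsP; exists p.2.
by rewrite eqxx andbT.
Qed.

Notation "p ;; q" := (Seq p q) (at level 60, right associativity).

Notation rN := 0 (only parsing).
Notation rJ := 4 (only parsing).
Notation rHi := 5 (only parsing).
Notation rW := 6 (only parsing).

(** The loop over the neighbours of the vertex in register v; the current
    neighbour is in register [rW]. *)
Definition for_neighbours v p :=
  (Assign rHi (Add (Reg v) (Imm 1)) ;; Assign rHi (Read 0 (Reg rHi)) ;;
   Assign rW (Read 0 (Reg v))) ;;
  For rJ (Reg rW) (Reg rHi) (Assign rW (Read 1 (Reg rJ)) ;; p).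

(** The programs below only write numbers of at most [(2 * m + n + 2) * (n + 2)],
    where m is the number of edges.  This bound is needed by the keys of the
    trie of neighbourhoods, which has at most 2 m + 1 nodes, each of them
    numbered by a multiple of n. *)
Section Input.

Variables (n : nat) (G : sgraph 'I_n) (L : 'I_n -> seq 'I_n) (m W : nat).
Hypothesis sum_L : \sum_(v < n) size (L v) <= 2 * m.
Hypothesis leW : (2 * m + n + 2) * (n + 2) <= W.

Definition offset v := \sum_(u < n | u < v) size (L u).

Definition input_ok s :=
  [/\ reg s rN = n,
      forall u : 'I_n, mem s 0 u = offset u,
      forall u : 'I_n, mem s 0 u.+1 = offset u + size (L u) &
      forall (u : 'I_n) i, i < size (L u) ->
        mem s 1 (offset u + i) = nth 0 (map val (L u)) i].

Lemma offset_succ (u : 'I_n) : offset u.+1 = offset u + size (L u).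
Proof.
rewrite /offset (bigD1 u) //= addnC; congr (_ + _); apply: eq_bigl => v.
by rewrite ltnS [in RHS]ltn_neqAle andbC.
Qed.

Lemma offset_le v : offset v <= 2 * m.
Proof.
apply: leq_trans sum_L; rewrite /offset [leqRHS](bigID (fun u : 'I_n => u < v)).
exact: leq_addr.
Qed.

Lemma input_initial : input_ok (initial_state L).
Proof.
have nth_offset (k : nat) : k <= n ->
    mem (initial_state L) 0 k = offset k.
  by move=> le_kn; rewrite /= nth_mkseq.
split=> [//|u|u|u i lt_i]; rewrite ?nth_offset ?offset_succ //.
  exact: ltnW.
rewrite /= -[enum _](cat_take_drop u) (drop_nth u) ?size_enum_ord //.
rewrite nth_ord_enum map_cat flatten_cat /=.
have size_u : size (flatten [seq [seq val w | w <- L v] |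
                             v <- take u (enum 'I_n)]) = offset u.
  elim: {u lt_i} (val u) (ltnW (ltn_ord u)) => [|k IHk] lt_kn.
    by rewrite take0 /offset big_pred0.
  pose v := Ordinal lt_kn; rewrite (take_nth v) ?size_enum_ord //.
  rewrite map_rcons flatten_rcons size_cat IHk ?(ltnW lt_kn) //.
  by rewrite (nth_ord_enum v v) size_map (offset_succ v).
rewrite nth_cat size_u ltnNge leq_addr /= addKn nth_cat size_map lt_i.
by [].
Qed.

Lemma input_agree rs ars s s' :
  agree rs ars s s' -> rN \notin rs -> 0 \notin ars -> 1 \notin ars ->
  input_ok s -> input_ok s'.
Proof.
move=> [eq_r eq_a] rN_N a0N a1N [n_s off_s off1_s list_s].
by split=> [|u|u|u i lt_i]; rewrite ?eq_r ?eq_a //; apply: list_s.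
Qed.

(** The invariant is indexed by the neighbours that have been visited.  The
    updates of the loop registers appear in the premises with arbitrary values:
    for a concrete invariant they simplify away. *)
Lemma runs_neighbours v (u : 'I_n) p s T (Inv : seq 'I_n -> state -> Prop) :
  input_ok s -> reg s v = u ->
  v != rHi -> rJ \notin wregs p -> rHi \notin wregs p -> 1 \notin warrs p ->
  (forall a b c d, Inv [::]
     (set_reg (set_reg (set_reg (set_reg s rHi a) rHi b) rW c) rJ d)) ->
  (forall pre x post s1, L u = pre ++ x :: post ->
     agree (rJ :: rHi :: rW :: wregs p) (warrs p) s s1 -> Inv pre s1 ->
     runs W p (set_reg s1 rW x) T
       (fun s2 => forall c, Inv (rcons pre x) (set_reg s2 rJ c))) ->
  runs W (for_neighbours v p) s (5 + (T + 3) * size (L u)) (Inv (L u)).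
Proof.
move=> in_s s_v vNhi jNp hiNp a1Np Inv0 step.
have [s_n s_off s_off1 s_list] := in_s.
have le_off : offset u + size (L u) <= W.
  have := offset_le u.+1; rewrite offset_succ; move: leW; nia.
have lt_uW : u.+1 <= W by have := ltn_ord u; move: leW; nia.
set len := size (L u); set o := offset u.
pose after s1 := [/\ agree [:: rHi; rW] [::] s s1,
  reg s1 rHi = o + len, reg s1 rW = o & forall d, Inv [::] (set_reg s1 rJ d)].
have setup : runs W (Assign rHi (Add (Reg v) (Imm 1)) ;;
    Assign rHi (Read 0 (Reg rHi)) ;; Assign rW (Read 0 (Reg v))) s 3 after.
  apply: runs_wp; rewrite /= s_v addn1 (negPf vNhi) s_off1 s_off.
  split=> //; split=> //; split; first exact: leq_trans (leq_addr _ _) le_off.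
  split=> //; split=> //= x; rewrite !inE negb_or.
  by case/andP=> /negPf-> /negPf->.
apply: runs_weaken (runs_seq setup _) _ _ => [s1 _ [ag1 s1_hi s1_w Inv1]||].
- have := @runs_for W rJ (Reg rW) (Reg rHi) (Assign rW (Read 1 (Reg rJ)) ;; p)
    s1 (fun _ => 1 + T) (fun k s2 => Inv (take (k - o) (L u)) s2).
  rewrite /= s1_hi s1_w => loop; apply: loop; rewrite ?leq_addr //.
  + by rewrite subnn take0.
  move=> k s2 /andP[le_ok lt_k] ag2 s2_j Inv_k.
  have lt_i : k - o < len by lia.
  have [x0 _] : exists x0 : 'I_n, True by exists u.
  set x := nth x0 (L u) (k - o).
  have read_k : mem s2 1 k = x.
    rewrite (proj2 ag2) // (proj2 ag1) // -{1}(subnKC le_ok) s_list //.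
    exact: nth_map.
  apply: (@runs_seq _ _ _ _ _ _ (fun s3 => s3 = set_reg s2 rW x)).
    exists 1, (set_reg s2 rW x); split=> //.
    rewrite -[val x]/(nat_of_ord x) -read_k -s2_j; apply: ExecAssign.
    by rewrite /= s2_j read_k; have := ltn_ord x; move: leW; nia.
  move=> s3 _ ->.
  have def_L : L u = take (k - o) (L u) ++ x :: drop (k - o).+1 (L u).
    by rewrite -drop_nth // cat_take_drop.
  apply: runs_weaken (step _ _ _ s2 def_L _ Inv_k) _ _ => //.
    apply: (agree_trans (s2 := s1)).
      by apply: agree_sub ag1 => y //; rewrite !inE => /orP[] ->; rewrite ?orbT.
    by apply: agree_sub ag2 => y //; rewrite !inE; case/orP=> [->|] //=;
       case/orP=> ->; rewrite ?orbT.
  by move=> s4 _ /(_ k.+1); rewrite subSn // (take_nth x0).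
- rewrite sum_nat_const_nat addKn; lia.
by move=> s' _ /=; rewrite addKn take_size.
Qed.

(** The time bound of the loop over all vertices is where the linear running time
    comes from: an iteration may take time proportional to the degree. *)
Lemma runs_vertices i p s a b (Inv : nat -> state -> Prop) :
  input_ok s -> i \notin wregs p -> rN \notin i :: wregs p ->
  Inv 0 (set_reg s i 0) ->
  (forall (v : 'I_n) s1, agree (i :: wregs p) (warrs p) s s1 ->
     reg s1 i = v -> Inv v s1 ->
     runs W p s1 (a + b * size (L v))
       (fun s2 => Inv v.+1 (set_reg s2 i v.+1))) ->
  runs W (For i (Imm 0) (Reg rN) p) s (2 + (a + 2) * n + b * (2 * m)) (Inv n).
Proof.
move=> [s_n _ _ _] iNp nNp Inv0 step.
pose T k := a + b * oapp (fun v => size (L v)) 0 (insub k : option 'I_n).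
have := @runs_for W i (Imm 0) (Reg rN) p s T Inv.
rewrite /= s_n => loop; apply: runs_weaken (loop iNp nNp _ _ Inv0 _) _ _ => //.
- by move: leW; nia.
- move=> k s1 lt_kn ag s1_i Inv_k.
  have -> : k = Ordinal lt_kn by [].
  by rewrite /T valK; apply: step.
rewrite -addnA leq_add2l big_mkord.
rewrite (eq_bigr (fun u : 'I_n => (a + 2) + b * size (L u))) => [|u _].
  by rewrite big_split sum_nat_const card_ord -big_distrr mulnC leq_add2l leq_mul.
by rewrite /T valK addnAC.
Qed.

End Input.

(** * The adjacency matrix and the twin classes *)

(* Registers: the current vertex v, two scratch values, n * v, and the largest
   node number of the trie. *)
Notation rV := 3 (only parsing).
Notation rT := 7 (only parsing).
Notation rKey := 8 (only parsing).
Notation rBase := 9 (only parsing).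
Notation rCnt := 10 (only parsing).

(* Arrays: the adjacency matrix, with the entry for u and w at n * u + w; the
   trie, with the child of node q along v at q + v; the node of each vertex;
   the multiples of n. *)
Notation aAdj := 5 (only parsing).
Notation aTrie := 6 (only parsing).
Notation aNode := 7 (only parsing).
Notation aRow := 9 (only parsing).

(** A trie of neighbourhoods stores the set of neighbours of each vertex as a
    path from the root, read in increasing order.  When v is processed, each
    neighbour of v moves from its node to the child along v, which is created
    if it does not exist.  Since all vertices advance together, the lists need
    not be sorted, and the initial zeros of the memory make it possible to
    store the trie in a table of size quadratic in the input without ever
    clearing it. *)
Definition refine_by_arc : cmd :=
  Assign rT (Add (Reg rBase) (Reg rW)) ;; Write aAdj (Reg rT) (Imm 1) ;;
  Assign rKey (Read aNode (Reg rW)) ;;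
  Assign rKey (Add (Reg rKey) (Reg rV)) ;;
  Assign rT (Read aTrie (Reg rKey)) ;;
  If (Eq (Reg rT) (Imm 0))
    (Assign rCnt (Add (Reg rCnt) (Reg rN)) ;; Assign rT (Val (Reg rCnt)) ;;
     Write aTrie (Reg rKey) (Reg rT))
    Skip ;;
  Write aNode (Reg rW) (Reg rT).

Definition build : cmd :=
  For rV (Imm 0) (Reg rN)
    (Write aRow (Reg rV) (Reg rBase) ;;
     for_neighbours rV refine_by_arc ;;
     Assign rBase (Add (Reg rBase) (Reg rN))).

Lemma pair_code_eq n q q' i i' : i < n -> i' < n ->
  (q * n + i == q' * n + i') = (q == q') && (i == i').
Proof.
move=> lt_i lt_i'; have n_gt0 : 0 < n by apply: leq_ltn_trans lt_i.
apply/eqP/andP=> [eq_qi | [/eqP-> /eqP->] //].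
have eq_q : q = q'.
  by have := congr1 (divn^~ n) eq_qi; rewrite !divnMDl // !divn_small ?addn0.
by move: eq_qi; rewrite eq_q => /addnI->.
Qed.

Lemma pair_code_inj n (w w' : 'I_n) q q' :
  (q * n + w == q' * n + w') = (q == q') && (w == w').
Proof. exact: pair_code_eq. Qed.

Section Build.

Variables (n : nat) (G : sgraph 'I_n) (L : 'I_n -> seq 'I_n) (m W : nat).
Hypothesis adjL : adjacency_lists G L.
Hypothesis sum_L : \sum_(v < n) size (L v) <= 2 * m.
Hypothesis leW : (2 * m + n + 2) * (n + 2) <= W.

Lemma mem_neighbours v w : (w \in L v) = adj G v w.
Proof. by have [_ ->] := adjL v; rewrite inE. Qed.

Definition matrix_ok s :=
  (forall u : 'I_n, mem s aRow u = u * n) /\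
  (forall u w : 'I_n, mem s aAdj (u * n + w) = adj G u w).

Lemma matrix_agree rs ars s s' :
  agree rs ars s s' -> aRow \notin ars -> aAdj \notin ars ->
  matrix_ok s -> matrix_ok s'.
Proof.
move=> [_ eq_a] rowN adjN [s_row s_adj].
by split=> [u|u w]; rewrite eq_a // ?s_row ?s_adj.
Qed.

Definition nodes_ok s :=
  (forall w : 'I_n, mem s aNode w <= W) /\
  (forall w w' : 'I_n,
    mem s aNode w = mem s aNode w' <-> adj G w =1 adj G w').

(** Before v = k is processed, two vertices are at the same node if and only if
    they have the same neighbours among the vertices below k, and no node has a
    child along k or a later vertex. *)
Definition build_inv k s :=
  [/\ reg s rBase = k * n,
      exists2 q, reg s rCnt = q * n & q <= offset L k,
      forall u : 'I_n, u < k -> mem s aRow u = u * n,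
      forall u w : 'I_n, mem s aAdj (u * n + w) = (u < k) && adj G u w &
   [/\ forall q (u : 'I_n), k <= u -> mem s aTrie (q * n + u) = 0,
      forall w : 'I_n, mem s aNode w <= reg s rCnt,
      forall w : 'I_n, exists q, mem s aNode w = q * n &
      forall w w' : 'I_n, mem s aNode w = mem s aNode w' <->
        forall u : 'I_n, u < k -> adj G u w = adj G u w']].

(** While v is processed, [node0] gives the nodes before v, and [q0 * n] is the
    largest node number at that time.  Nodes above it are new, which separates
    the neighbours of v from the other vertices; and distinct nodes have
    distinct children along v. *)
Definition arc_inv (v : 'I_n) (node0 : nat -> nat) q0 (pre : seq 'I_n) s :=
  [/\ exists q, [/\ reg s rCnt = q * n, q0 <= q & q <= q0 + size pre],
      forall u w : 'I_n, mem s aAdj (u * n + w) =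
        (u < v) && adj G u w || (u == v) && (w \in pre),
      forall q (u : 'I_n), v < u -> mem s aTrie (q * n + u) = 0 &
  [/\ forall q, mem s aTrie (q * n + v) = 0 \/
        q0 * n < mem s aTrie (q * n + v) <= reg s rCnt /\
        exists p, mem s aTrie (q * n + v) = p * n,
      forall q q', mem s aTrie (q * n + v) != 0 ->
        mem s aTrie (q * n + v) = mem s aTrie (q' * n + v) -> q = q',
      forall w : 'I_n, w \in pre -> q0 * n < mem s aNode w /\
        mem s aNode w = mem s aTrie (node0 w + v) &
      forall w : 'I_n, w \notin pre -> mem s aNode w = node0 w]].

Lemma refine_by_arc_runs (v x : 'I_n) (node0 : nat -> nat) q0 pre post s :
  L v = pre ++ x :: post -> q0 <= offset L v ->
  reg s rN = n -> reg s rV = v -> reg s rBase = v * n ->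
  (forall w : 'I_n, node0 w <= q0 * n /\ exists q, node0 w = q * n) ->
  arc_inv v node0 q0 pre s ->
  runs W refine_by_arc (set_reg s rW x) (cost refine_by_arc)
    (fun s' => forall c, arc_inv v node0 q0 (rcons pre x) (set_reg s' rJ c)).
Proof.
move=> def_L le_q0 s_n s_v s_base node0_ok.
case=> [[q [s_cnt le_q0q le_q]] inv_adj inv_later].
case=> [inv_trie inv_inj inv_in inv_out].
have n_gt0 : 0 < n by have := ltn_ord x; lia.
have x_pre : x \notin pre.
  have [uniq_v _] := adjL v; move: uniq_v; rewrite def_L cat_uniq /=.
  by rewrite negb_or => /and3P[_ /andP[]].
have [le_node [qx node_x]] := node0_ok x.
have le_qm : q.+1 <= 2 * m.
  have := offset_le sum_L v.+1; rewrite offset_succ def_L size_cat /=; lia.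
have W_q : q.+1 * n + n <= W.
  by apply: leq_trans leW; nia.
have W_sq : n * n + n <= W by apply: leq_trans leW; nia.
have W_vx : v * n + x <= W.
  apply: leq_trans W_sq; have := ltn_ord x; have := ltn_ord v; nia.
apply: runs_wp; rewrite /= s_n s_v s_base (inv_out x) // node_x.
have x_lt := ltn_ord x; have v_lt := ltn_ord v.
have le_qx : qx * n <= q * n.
  by rewrite -node_x (leq_trans le_node) // leq_mul2r le_q0q orbT.
rewrite mulSn in W_q.
have W_cnt : q * n <= W by lia.
have W_key : qx * n + v <= W by lia.
have W_trie : mem s aTrie (qx * n + v) <= W.
  by case: (inv_trie qx) => [-> // | [/andP[_]]]; rewrite s_cnt; lia.
have adj_mark (u w : 'I_n) :
    (if u * n + w == v * n + x then 1 else mem s aAdj (u * n + w)) =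
    (u < v) && adj G u w || (u == v) && (w \in rcons pre x).
  rewrite pair_code_inj inv_adj mem_rcons inE.
  rewrite -[u == v :> nat]/(u == v).
  by case: (u == v); case: (w == x); rewrite /= ?orbT ?orbF.
have notin_rcons (w : 'I_n) :
    w \notin rcons pre x -> (w == x) = false /\ w \notin pre.
  by rewrite mem_rcons inE negb_or => /andP[/negPf].
do 5 (split; first lia).
(* Case T0 creates the child of node qx along v, and case TN0 reuses it. *)
case: eqP => [T0 | /eqP TN0].
  do 4 (split; first by rewrite s_cnt; lia).
  rewrite s_cnt -mulSnr => c; split; rewrite /= ?size_rcons //.
  - by exists q.+1; split=> //; lia.
  - move=> p u lt_vu; rewrite pair_code_inj.
    by rewrite (negPf (_ : u != v)) ?andbF ?inv_later // neq_ltn lt_vu orbT.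
  split.
  - move=> p; case: eqP => [_ | _].
      right; split; last by exists q.+1.
      by rewrite leqnn andbT ltn_pmul2r // ltnS.
    case: (inv_trie p) => [-> | [le_p ex_p]]; [by left | right; split=> //].
    case/andP: le_p => -> le_p; apply: leq_trans le_p _.
    by rewrite s_cnt leq_mul2r leqnSn orbT.
  - have old p : mem s aTrie (p * n + v) != q.+1 * n.
      case: (inv_trie p) => [-> | [/andP[_]]].
        by rewrite eq_sym muln_eq0 -lt0n n_gt0.
      by rewrite s_cnt => le_p _; rewrite neq_ltn mulSn; lia.
    move=> p p'; rewrite !pair_code_inj !eqxx !andbT.
    case: (p =P qx) => [-> | _]; case: (p' =P qx) => [-> // | _] TpN0 eq_T.
    + by case/eqP: (old p').
    + by case/eqP: (old p).
    exact: inv_inj TpN0 eq_T.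
  - move=> w; rewrite mem_rcons inE -[w == x :> nat]/(w == x).
    case: (w =P x) => [-> _ | _ /= w_pre].
      by rewrite node_x eqxx ltn_pmul2r // ltnS.
    have [lt_w def_w] := inv_in w w_pre; split=> //.
    have [_ [p node_w]] := node0_ok w.
    rewrite def_w node_w in lt_w *; rewrite pair_code_inj.
    by case: (p =P qx) lt_w => //= ->; rewrite T0.
  move=> w /notin_rcons[wNx w_pre]; rewrite -[w == x :> nat]/(w == x) wNx.
  exact: inv_out.
split=> // c; split; rewrite /= ?size_rcons //.
- by exists q; split=> //; lia.
split=> // w.
  rewrite mem_rcons inE -[w == x :> nat]/(w == x).
  case: (w =P x) => [-> _ | _ /= /inv_in //].
  rewrite node_x.
  by case: (inv_trie qx) => [/eqP | [/andP[]]]; rewrite ?(negPf TN0).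
move=> /notin_rcons[wNx w_pre]; rewrite -[w == x :> nat]/(w == x) wNx.
exact: inv_out.
Qed.

(** At the end of the loop over the neighbours of v: two neighbours are at the same
    node if and only if they were before, a neighbour and a non-neighbour never
    are, and non-neighbours have not moved. *)
Lemma build_step (v : 'I_n) s :
  input_ok L s -> reg s rV = v -> build_inv v s ->
  runs W (Write aRow (Reg rV) (Reg rBase) ;;
          for_neighbours rV refine_by_arc ;;
          Assign rBase (Add (Reg rBase) (Reg rN))) s
    (7 + (cost refine_by_arc + 3) * size (L v))
    (fun s2 => build_inv v.+1 (set_reg s2 rV v.+1)).
Proof.
move=> in_s s_v [s_base [q0 s_cnt le_q0] inv_row inv_adj].
case=> [inv_trie inv_le inv_mul inv_eq].
have W_base : v * n + n <= W.
  by apply: leq_trans leW; have := ltn_ord v; nia.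
pose s1 := set_mem s aRow v (v * n).
apply: runs_weaken (_ : runs W _ s
    (1 + (5 + (cost refine_by_arc + 3) * size (L v) + 1))
    (fun s2 => build_inv v.+1 (set_reg s2 rV v.+1))) _ _.
- apply: (@runs_seq _ _ _ _ _ _ (fun s' => s' = s1)).
    apply: runs_wp; rewrite /= s_base s_v; split=> //; lia.
  move=> _ _ ->; apply: runs_seq.
    apply: (runs_neighbours sum_L leW (v := rV) (u := v) (s := s1)
              (Inv := arc_inv v (mem s aNode) q0)) => //.
    + move=> a b c d; split=> //=.
      * by exists q0; rewrite ?addn0.
      * by move=> u w; rewrite inv_adj in_nil andbF orbF.
      * by move=> q u /ltnW/inv_trie.
      split=> // [q|q q']; last by rewrite inv_trie.
      by left; apply: inv_trie.
    + move=> pre x post s2 def_L [ag_r ag_a] inv.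
      have [s_n _ _ _] := in_s.
      apply: (@refine_by_arc_runs _ _ _ _ _ post) => //; rewrite ?ag_r //.
      move=> w; have [q node_w] := inv_mul w.
      by rewrite -s_cnt; split; [exact: inv_le | exists q].
  move=> s2 [ag_r ag_a] [[q [cnt_q le_q0q le_q]] adj2 later2].
  case=> [trie2 inj2 in2 out2].
  have [s_n _ _ _] := in_s.
  have [base2 n2] : reg s2 rBase = v * n /\ reg s2 rN = n by rewrite !ag_r.
  apply: runs_wp; rewrite /= base2 n2; split=> //; split; rewrite //= -?mulSnr //.
  - by exists q; rewrite ?offset_succ //; lia.
  - move=> u; rewrite ltnS leq_eqVlt ag_a //= => /predU1P[-> | lt_uv].
      by rewrite eqxx.
    by rewrite ltn_eqF // inv_row.
  - move=> u w; rewrite adj2 mem_neighbours ltnS [u <= v]leq_eqVlt.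
    rewrite -[u == v :> nat]/(u == v).
    case: eqVneq => [-> | _]; last by rewrite orbF.
    by rewrite ltnn.
  split=> [p u lt_vu|w|w|w w'].
  - by rewrite later2.
  - case: (boolP (w \in L v)) => [/in2[_ ->] | /out2->].
      by have [q1 ->] := inv_mul w; case: (trie2 q1) => [->|[/andP[]]].
    by rewrite cnt_q (leq_trans (inv_le w)) // s_cnt leq_mul2r le_q0q orbT.
  - case: (boolP (w \in L v)) => [/in2[_ ->] | /out2->]; last exact: inv_mul.
    have [q1 ->] := inv_mul w; case: (trie2 q1) => [->|[_ //]].
    by exists 0.
  have fresh w1 w2 : w1 \in L v -> w2 \notin L v ->
      mem s2 aNode w1 <> mem s2 aNode w2.
    case/in2=> lt_w1 _ /out2-> eq_w; have := inv_le w2.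
    by rewrite -eq_w s_cnt leqNgt lt_w1.
  have split_v : (forall u : 'I_n, u < v.+1 -> adj G u w = adj G u w') <->
    adj G v w = adj G v w' /\
    (forall u : 'I_n, u < v -> adj G u w = adj G u w').
    split=> [eq_ww' | [eq_v eq_lt] u].
      by split=> [|u lt_uv]; apply: eq_ww'; rewrite // ltnS ltnW.
    by rewrite ltnS leq_eqVlt => /predU1P[/val_inj-> | /eq_lt].
  rewrite split_v -inv_eq -!mem_neighbours.
  case: (boolP (w \in L v)) => wv; case: (boolP (w' \in L v)) => wv'.
  - have [lt_w ->] := in2 _ wv; have [_ ->] := in2 _ wv'.
    have [q1 node_w] := inv_mul w; have [q2 node_w'] := inv_mul w'.
    rewrite node_w node_w'; split=> [eq_trie | [_ ->] //]; split=> //.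
    congr (_ * _); apply: inj2 eq_trie.
    by case/in2: wv => + def_w; rewrite def_w node_w; lia.
  - by split=> [/fresh-/(_ wv wv') | []].
  - by split=> [/esym/fresh-/(_ wv' wv) | []].
  by rewrite !out2 //; split=> [|[]].
- lia.
by [].
Qed.

Lemma build_runs :
  runs W build (initial_state L) (2 + 30 * n + 20 * (2 * m))
    (fun s => [/\ input_ok L s, matrix_ok s & nodes_ok s]).
Proof.
have in0 := input_initial L.
apply: runs_weaken
  (runs_vertices sum_L leW (Inv := build_inv) in0 _ _ _ _ ) _ _ => //.
- split=> //=; first by exists 0.
  by split=> // w; exists 0.
- move=> v s1 ag s1_v inv; apply: build_step => //.
  exact: input_agree ag _ _ _ in0.
- rewrite /=; lia.
move=> s ag [_ [q cnt_q le_q] row adj_s [_ le_node _ eq_node]]; split.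
- exact: input_agree ag _ _ _ in0.
- by split=> u; rewrite ?row // => w; rewrite adj_s ltn_ord.
split=> [w | w w'].
  apply: leq_trans (le_node w) _; rewrite cnt_q.
  have := offset_le sum_L n; move: leW; nia.
rewrite eq_node; split=> eq_ww' u; first by rewrite !(adj_sym _ _ u) eq_ww'.
by rewrite !(adj_sym _ u).
Qed.

End Build.

(** * Colouring by twin classes *)

(* The number of colours. *)
Notation rK := 1 (only parsing).
(* The colour of each vertex; for each node of the trie, 1 plus its colour, or 0
   if it has none yet; the indicator of the representatives. *)
Notation aCol := 2 (only parsing).
Notation aClass := 8 (only parsing).
Notation aRep := 10 (only parsing).

(** The first vertex of a twin class gets a new colour and represents it. *)
Definition colour_vertex : cmd :=
  Assign rKey (Read aNode (Reg rV)) ;; Assign rT (Read aClass (Reg rKey)) ;;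
  If (Eq (Reg rT) (Imm 0))
    (Write aRep (Reg rV) (Imm 1) ;; Assign rK (Add (Reg rK) (Imm 1)) ;;
     Assign rT (Val (Reg rK)) ;; Write aClass (Reg rKey) (Reg rT))
    Skip ;;
  Assign rT (Sub (Reg rT) (Imm 1)) ;; Write aCol (Reg rV) (Reg rT).

Definition colour : cmd := For rV (Imm 0) (Reg rN) colour_vertex.

Section Colour.

Variables (n : nat) (G : sgraph 'I_n) (L : 'I_n -> seq 'I_n) (m W : nat).
Hypothesis sum_L : \sum_(v < n) size (L v) <= 2 * m.
Hypothesis leW : (2 * m + n + 2) * (n + 2) <= W.

Definition colouring_ok k (c : 'I_n -> 'I_k) (R : {set 'I_n}) s :=
  [/\ reg s rK = k, forall u : 'I_n, mem s aCol u = c u &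
      forall u : 'I_n, mem s aRep u = (u \in R)].

Definition colour_inv (node : nat -> nat) k s :=
  [/\ reg s rK <= k,
      forall u : 'I_n, u < k -> mem s aCol u < reg s rK,
      forall u v : 'I_n, u < k -> v < k ->
        mem s aCol u = mem s aCol v <-> node u = node v,
      forall v : 'I_n, (mem s aClass (node v) = 0 /\
          forall u : 'I_n, u < k -> node u <> node v) \/
        exists u : 'I_n, [/\ u < k, node u = node v &
                          mem s aClass (node v) = (mem s aCol u).+1] &
  [/\ forall x, x < reg s rK ->
        exists u : 'I_n, [/\ u < k, mem s aRep u = 1 & mem s aCol u = x],
      forall u : 'I_n, mem s aRep u = (mem s aRep u == 1),
      forall u : 'I_n, k <= u -> mem s aRep u = 0 &
      forall u v : 'I_n, mem s aRep u = 1 -> mem s aRep v = 1 ->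
        node u = node v -> u = v]].

Lemma colour_step (v : 'I_n) node s :
  reg s rV = v -> mem s aNode =1 node -> (forall u : 'I_n, node u <= W) ->
  colour_inv node v s ->
  runs W colour_vertex s (cost colour_vertex)
    (fun s2 => colour_inv node v.+1 (set_reg s2 rV v.+1)).
Proof.
move=> s_v s_node le_node.
case=> [le_k col_lt col_eq class [onto rep_bool rep_new rep_inj]].
have v_lt := ltn_ord v.
have ltS_eq (u : 'I_n) : (u < v.+1) = (u == v) || (u < v).
  by rewrite ltnS leq_eqVlt.
have W_n : n + 2 <= W by move: leW; nia.
apply: runs_wp; rewrite /= s_v s_node; split; first exact: le_node.
case: (class v) => [[class0 new_v] | [u0 [lt_u0 node_u0 class_v]]].
  rewrite class0; split=> //=; do 4 (split; first lia).
  rewrite addn1 subn1 /=; do 2 (split; first lia).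
  split; rewrite /= ?val_eqE.
  - exact: le_k.
  - move=> u; rewrite ltS_eq val_eqE => /predU1P[->|lt_uv].
      by rewrite eqxx.
    by rewrite -val_eqE /= ltn_eqF // ltnS ltnW ?col_lt.
  - move=> u w; rewrite !ltS_eq !val_eqE.
    case: eqVneq => [-> | uNv] /=; case: eqVneq => [-> | wNv] //=.
    + move=> _ lt_w; have lt_c := col_lt w lt_w.
      split=> [eq_c | /esym/(new_v w lt_w) //].
      by rewrite -eq_c ltnn in lt_c.
    + move=> lt_u _; have lt_c := col_lt u lt_u.
      split=> [eq_c | /(new_v u lt_u) //].
      by rewrite eq_c ltnn in lt_c.
    exact: col_eq.
  - move=> u; case: (eqVneq (node u) (node v)) => [-> | uNv].
      by right; exists v; rewrite !eqxx.
    case: (class u) => [[-> new_u] | [w [lt_w node_w class_u]]].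
      left; split=> // w; rewrite ltS_eq => /predU1P[-> |].
        by move/eqP; rewrite eq_sym (negPf uNv).
      exact: new_u.
    by right; exists w; rewrite ltnS (ltnW lt_w) (ltn_eqF lt_w).
  split.
  - move=> x; rewrite ltnS leq_eqVlt => /predU1P[-> | lt_x].
      by exists v; rewrite ltnSn val_eqE eqxx.
    have [u [lt_u rep_u col_u]] := onto x lt_x.
    by exists u; rewrite ltn_eqF //= ltnS ltnW.
  - by move=> u; rewrite val_eqE; case: ifP => // _; apply: rep_bool.
  - by move=> u lt_vu; rewrite gtn_eqF // rep_new // ltnW.
  have new_rep (w : 'I_n) : mem s aRep w = 1 -> node w <> node v.
    move=> rep_w; apply: (new_v w); rewrite ltnNge.
    by apply: contra_eqN rep_w => /rep_new->.
  move=> u w; rewrite !val_eqE.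
  case: eqVneq => [-> | uNv]; case: eqVneq => [-> | wNv] //.
  - by move=> _ /new_rep + /esym.
  - by move=> /new_rep.
  exact: rep_inj.
have lt_c := col_lt u0 lt_u0.
rewrite class_v /= subn1 /=; do 3 (split; first lia).
split; rewrite /= ?val_eqE.
- exact: leqW.
- move=> u; rewrite ltS_eq val_eqE => /predU1P[->|lt_uv].
    by rewrite eqxx.
  by rewrite -val_eqE /= ltn_eqF // col_lt.
- move=> u w; rewrite !ltS_eq !val_eqE.
  case: eqVneq => [-> | uNv] /=; case: eqVneq => [-> | wNv] //=.
  + by move=> _ lt_w; rewrite -node_u0; apply: col_eq.
  + by move=> lt_u _; rewrite -node_u0; apply: col_eq.
  exact: col_eq.
- move=> u; case: (class u) => [[-> new_u] | [w [lt_w node_w class_u]]].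
    left; split=> // w; rewrite ltS_eq => /predU1P[-> |].
      by rewrite -node_u0; apply: new_u.
    exact: new_u.
  by right; exists w; rewrite ltnS (ltnW lt_w) (ltn_eqF lt_w).
split=> //.
- move=> x lt_x; have [u [lt_u rep_u col_u]] := onto x lt_x.
  by exists u; rewrite ltn_eqF //= ltnS ltnW.
by move=> u /ltnW; apply: rep_new.
Qed.

Lemma colour_runs s :
  input_ok L s -> nodes_ok G W s -> reg s rK = 0 ->
  mem s aClass =1 (fun=> 0) -> mem s aRep =1 (fun=> 0) ->
  runs W colour s (2 + 20 * n)
    (fun s' => exists k (c : 'I_n -> 'I_k) (R : {set 'I_n}),
      k <= n /\ twin_colouring G c R /\ colouring_ok c R s').
Proof.
move=> in_s [le_node eq_node] K0 class0 rep0.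
apply: runs_weaken (runs_vertices sum_L leW (a := cost colour_vertex) (b := 0)
  (Inv := colour_inv (mem s aNode)) in_s _ _ _ _) _ _ => //.
- split; rewrite /= ?K0 //; first by left; rewrite class0.
  by split=> [x|u|u|u v]; rewrite /= ?rep0.
- move=> v s1 [ag_r ag_a] s1_v inv; rewrite mul0n addn0.
  by apply: colour_step => // i; apply: ag_a.
- rewrite /=; lia.
move=> s' ag [le_k col_lt col_eq _ [onto rep_bool _ rep_inj]].
pose c (u : 'I_n) := Ordinal (col_lt u (ltn_ord u)).
pose R := [set u : 'I_n | mem s' aRep u == 1].
exists (reg s' rK), c, R; split=> //; split; split=> //.
- move=> u v; rewrite -eq_node -col_eq //.
  by split=> [/(congr1 val) | eq_c]; last exact: val_inj.
- move=> x; have [u [_ rep_u col_u]] := onto x (ltn_ord x).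
  by exists u; [rewrite inE rep_u | apply: val_inj].
- move=> u v; rewrite !inE => /eqP Ru /eqP Rv /(congr1 val) /= eq_c.
  by apply: rep_inj => //; apply/col_eq.
by move=> u; rewrite inE -rep_bool.
Qed.

End Colour.

(** * Sorting the representatives by degree *)

(* The current degree and the number of collected vertices. *)
Notation rD := 11 (only parsing).
Notation rPos := 12 (only parsing).
(* The sizes of the buckets; the buckets, that of degree d starting at n * d; the
   sorted sequence. *)
Notation aLen := 11 (only parsing).
Notation aBucket := 12 (only parsing).
Notation aOrder := 13 (only parsing).

(** A bucket sort by degree within the set of representatives, that is, by degree
    in the quotient by twins. *)
Definition count_representative : cmd :=
  Assign rT (Read aRep (Reg rW)) ;; Assign rD (Add (Reg rD) (Reg rT)).

Definition push_vertex : cmd :=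
  Assign rT (Read aLen (Reg rD)) ;; Assign rKey (Read aRow (Reg rD)) ;;
  Assign rKey (Add (Reg rKey) (Reg rT)) ;; Write aBucket (Reg rKey) (Reg rV) ;;
  Assign rT (Add (Reg rT) (Imm 1)) ;; Write aLen (Reg rD) (Reg rT).

Definition distribute_vertex : cmd :=
  Assign rT (Read aRep (Reg rV)) ;;
  If (Eq (Reg rT) (Imm 1))
    (Assign rD (Val (Imm 0)) ;;
     for_neighbours rV count_representative ;;
     push_vertex)
    Skip.

Definition distribute : cmd := For rV (Imm 0) (Reg rN) distribute_vertex.

Definition pop_vertex : cmd :=
  Assign rT (Add (Reg rKey) (Reg rJ)) ;; Assign rT (Read aBucket (Reg rT)) ;;
  Write aOrder (Reg rPos) (Reg rT) ;; Assign rPos (Add (Reg rPos) (Imm 1)).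

Definition collect : cmd :=
  For rD (Imm 0) (Reg rN)
    ((Assign rKey (Read aRow (Reg rD)) ;; Assign rHi (Read aLen (Reg rD))) ;;
     For rJ (Imm 0) (Reg rHi) pop_vertex).

Section Sorting.

Variables (n : nat) (G : sgraph 'I_n) (R : {set 'I_n}).

Definition rdegree v := #|[pred w in R | adj G v w]|.

Lemma rdegree_lt v : rdegree v < n.
Proof.
rewrite /rdegree -[ltnRHS]card_ord; apply/proper_card/properP.
by split; [apply/subsetP | exists v; rewrite // inE adj_irr andbF].
Qed.

(** Bucket d after the vertices below k have been distributed. *)
Definition bucket k d : seq 'I_n :=
  [seq u <- take k (enum 'I_n) | (u \in R) && (rdegree u == d)].

Definition collected k := flatten [seq bucket n d | d <- iota 0 k].

Lemma bucketS (v : 'I_n) d : bucket v.+1 d =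
  if (v \in R) && (rdegree v == d) then rcons (bucket v d) v else bucket v d.
Proof.
by rewrite /bucket (take_nth v) ?size_enum_ord // nth_ord_enum filter_rcons.
Qed.

Lemma size_bucket k d : k <= n -> size (bucket k d) <= k.
Proof.
move=> le_kn; apply: leq_trans (_ : size (take k (enum 'I_n)) <= k).
  by rewrite size_filter count_size.
by rewrite size_take size_enum_ord; case: ltnP.
Qed.

Lemma mem_bucket d v : (v \in bucket n d) = (v \in R) && (rdegree v == d).
Proof. by rewrite mem_filter take_oversize ?size_enum_ord // mem_enum andbT. Qed.

Lemma collectedS k : collected k.+1 = collected k ++ bucket n k.
Proof. by rewrite /collected -addn1 iotaD map_cat flatten_cat /= cats0. Qed.

Lemma mem_collected k v : (v \in collected k) = (v \in R) && (rdegree v < k).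
Proof.
elim: k => [|k IHk]; first by rewrite andbF.
rewrite collectedS mem_cat IHk mem_bucket -andb_orr orbC.
by rewrite ltnS [in RHS]leq_eqVlt.
Qed.

Lemma uniq_collected k : uniq (collected k).
Proof.
elim: k => [|k IHk] //; rewrite collectedS cat_uniq IHk /= filter_uniq.
  rewrite andbT; apply/hasPn=> v; rewrite mem_bucket mem_collected.
  by case/andP=> _ /eqP->; rewrite ltnn andbF.
by apply: take_uniq; apply: enum_uniq.
Qed.

Lemma sorted_collected k :
  pairwise (fun u v => rdegree u <= rdegree v) (collected k).
Proof.
elim: k => [|k IHk] //; rewrite collectedS pairwise_cat IHk /=.
apply/andP; split.
  apply/allrelP=> u v; rewrite mem_collected mem_bucket.
  by case/andP=> _ lt_u /andP[_ /eqP->]; apply: ltnW.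
case def_b: (bucket n k) => [//|x0 b]; rewrite -def_b.
apply/(pairwiseP x0) => i j lt_i lt_j _.
have := mem_nth x0 lt_i; have := mem_nth x0 lt_j.
by rewrite !mem_bucket => /andP[_ /eqP->] /andP[_ /eqP->].
Qed.

Lemma size_collected k : size (collected k) <= n.
Proof.
by rewrite -(card_uniqP (uniq_collected k)) -[leqRHS]card_ord max_card.
Qed.

End Sorting.

Section Sort.

Variables (n : nat) (G : sgraph 'I_n) (L : 'I_n -> seq 'I_n) (m W : nat).
Hypothesis adjL : adjacency_lists G L.
Hypothesis sum_L : \sum_(v < n) size (L v) <= 2 * m.
Hypothesis leW : (2 * m + n + 2) * (n + 2) <= W.
Variable R : {set 'I_n}.

Notation rdegree := (rdegree G R).
Notation bucket := (bucket G R).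
Notation collected := (collected G R).

Lemma count_neighbours v : count (fun w => w \in R) (L v) = rdegree v.
Proof.
have [uniq_v mem_v] := adjL v.
rewrite -size_filter -(card_uniqP (filter_uniq _ uniq_v)); apply: eq_card => w.
by rewrite mem_filter mem_v !inE.
Qed.

Definition buckets_ok k s :=
  forall d : 'I_n, mem s aLen d = size (bucket k d) /\
    forall i, i < size (bucket k d) ->
      mem s aBucket (d * n + i) = nth 0 (map val (bucket k d)) i.

Lemma buckets_agree rs ars s s' k :
  agree rs ars s s' -> aLen \notin ars -> aBucket \notin ars ->
  buckets_ok k s -> buckets_ok k s'.
Proof.
move=> [_ eq_a] lenN bucketN s_b d; have [len_d bucket_d] := s_b d.
by split=> [|i lt_i]; rewrite eq_a // bucket_d.
Qed.

Lemma count_runs (v : 'I_n) s :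
  input_ok L s -> reg s rV = v -> reg s rD = 0 ->
  (forall w : 'I_n, mem s aRep w = (w \in R)) ->
  runs W (for_neighbours rV count_representative) s (5 + 5 * size (L v))
    (fun s' => reg s' rD = rdegree v).
Proof.
move=> in_s s_v D0 s_rep.
apply: runs_weaken (runs_neighbours sum_L leW (v := rV) (u := v) (T := 2)
  (Inv := fun pre s' => reg s' rD = count (fun w => w \in R) pre)
  in_s s_v _ _ _ _ _ _) _ _ => //.
  move=> pre x post s1 def_L [ag_r ag_a] inv; apply: runs_wp.
  rewrite /= inv ag_a // s_rep.
  have le_c := count_size (fun w => w \in R) pre.
  have := offset_le sum_L v.+1; rewrite offset_succ def_L size_cat /= => le_L.
  have W_lin : 2 * m + 1 <= W by move: leW; nia.
  have c_W : count (fun w => w \in R) pre + 1 <= W.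
    apply: leq_trans W_lin; rewrite leq_add2r (leq_trans le_c) //.
    by apply: leq_trans le_L; rewrite addnCA leq_addr.
  split; first by apply: leq_trans (leq_b1 _) _; lia.
  split; first by apply: leq_trans c_W; rewrite leq_add2l leq_b1.
  by rewrite -cats1 count_cat /= addn0.
by move=> s' _ ->; apply: count_neighbours.
Qed.

Lemma push_runs (v : 'I_n) s :
  matrix_ok G s -> reg s rV = v -> reg s rD = rdegree v -> v \in R ->
  buckets_ok v s ->
  runs W push_vertex s 6 (fun s' => buckets_ok v.+1 s').
Proof.
move=> [s_row _] s_v s_d Rv inv; have lt_v := ltn_ord v.
pose d := Ordinal (rdegree_lt G R v).
have [len_d bucket_d] := inv d.
have le_b : size (bucket v d) <= v by apply: size_bucket; apply: ltnW.
have W_sq : n * n + n <= W by move: leW; nia.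
have W_lin : n + 2 <= W by move: leW; nia.
have W_row : rdegree v * n + n <= n * n.
  by have := rdegree_lt G R v; nia.
have row_d : mem s aRow (rdegree v) = rdegree v * n by apply: (s_row d).
have len_dn : mem s aLen (rdegree v) = size (bucket v d) by apply: len_d.
apply: runs_wp; rewrite /= s_d s_v len_dn row_d.
do 5 (split; first lia).
rewrite addn1; split; first lia.
move=> e; rewrite bucketS Rv /=.
case: (eqVneq d e) => [<- | dNe].
  rewrite !eqxx size_rcons; split=> // i.
  rewrite ltnS leq_eqVlt eqn_add2l map_rcons nth_rcons size_map.
  case/predU1P=> [-> | lt_i]; first by rewrite !eqxx ltnn.
  by rewrite lt_i ltn_eqF // bucket_d.
have /negPf dNe' : rdegree v != e by [].
have [len_e bucket_e] := inv e.
have le_be : size (bucket v e) <= v by apply: size_bucket; apply: ltnW.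
rewrite dNe' eq_sym dNe' /=; split=> // i lt_i; rewrite -bucket_e //.
have lt_in : i < n by apply: leq_trans lt_i (leq_trans le_be (ltnW _)).
have lt_bn : size (bucket v (rdegree v)) < n by apply: leq_ltn_trans lt_v.
by rewrite pair_code_eq // eq_sym dNe'.
Qed.

Lemma distribute_runs s :
  input_ok L s -> matrix_ok G s ->
  (forall w : 'I_n, mem s aRep w = (w \in R)) -> mem s aLen =1 (fun=> 0) ->
  runs W distribute s (2 + 20 * n + 5 * (2 * m))
    (fun s' => [/\ input_ok L s', matrix_ok G s' & buckets_ok n s']).
Proof.
move=> in_s mat_s s_rep len0.
apply: runs_weaken (runs_vertices sum_L leW (a := 14) (b := 5)
  (Inv := buckets_ok) in_s _ _ _ _) _ _ => //.
- by move=> d; rewrite /bucket take0 /= len0.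
- move=> v s1 ag s1_v inv.
  have [in1 mat1] : input_ok L s1 /\ matrix_ok G s1.
    split; first exact: input_agree ag _ _ _ in_s.
    exact: matrix_agree ag _ _ mat_s.
  have rep1 (w : 'I_n) : mem s1 aRep w = (w \in R) by rewrite (proj2 ag).
  have W_gt0 : 0 < W by move: leW; nia.
  apply: runs_weaken (_ : runs W _ _ (1 + (1 + (5 + 5 * size (L v) + 6)).+1)
    (fun s2 => buckets_ok v.+1 (set_reg s2 rV v.+1))) _ _ => //; last by lia.
  apply: (@runs_seq _ _ _ _ _ _ (fun s2 => s2 = set_reg s1 rT (v \in R))).
    apply: runs_wp; rewrite /= s1_v rep1; split=> //.
    exact: leq_trans (leq_b1 _) W_gt0.
  move=> _ _ ->; apply: runs_if => [/= Rv | /= RNv].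
    have {}Rv : v \in R by case: (v \in R) Rv.
    apply: (@runs_seq _ _ _ _ _ _
      (fun s2 => s2 = set_reg (set_reg s1 rT (v \in R)) rD 0)).
      exact: runs_wp.
    move=> _ _ ->; apply: runs_seq.
      by apply: count_runs.
    move=> s2 ag2 d2; have s2_v : reg s2 rV = v by rewrite (proj1 ag2).
    apply: runs_weaken (push_runs _ s2_v d2 Rv _) _ _ => //.
      exact: matrix_agree ag2 _ _ mat1.
    exact: buckets_agree ag2 _ _ inv.
  have /negPf RF : v \notin R by case: (v \in R) RNv.
  exists 1, (set_reg s1 rT (v \in R)); split=> //; first exact: ExecSkip.
  by move=> d; rewrite bucketS RF; apply: inv.
- rewrite /=; lia.
move=> s' ag inv; split=> //; first exact: input_agree ag _ _ _ in_s.
exact: matrix_agree ag _ _ mat_s.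
Qed.

Definition order_ok (o : seq 'I_n) s :=
  forall i, i < size o -> mem s aOrder i = nth 0 (map val o) i.

Lemma collect_runs s :
  input_ok L s -> matrix_ok G s -> buckets_ok n s -> reg s rPos = 0 ->
  runs W collect s (2 + 20 * n)
    (fun s' => reg s' rPos = size (collected n) /\ order_ok (collected n) s').
Proof.
move=> in_s mat_s b_s pos0; have [s_n _ _ _] := in_s.
have W_lin : 2 * n + 4 <= W by move: leW; nia.
have W_sq : n * n + n <= W by move: leW; nia.
pose inv k s' := reg s' rPos = size (collected k) /\ order_ok (collected k) s'.
pose T k := 4 + 6 * size (bucket n k).
have := @runs_for W rD (Imm 0) (Reg rN) _ s T inv.
rewrite /= s_n => loop; apply: runs_weaken (loop _ _ _ _ _ _ _) _ _ => {loop} //.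
- lia.
- move=> k s1 lt_kn ag s1_k [pos_k order_k].
  pose d := Ordinal lt_kn; have mat1 := matrix_agree ag isT isT mat_s.
  have [len_d bucket_d] := buckets_agree ag isT isT b_s d.
  have le_b : size (bucket n k) <= n by apply: size_bucket.
  have row_k : mem s1 aRow k = k * n by apply: (proj1 mat1 d).
  have W_k : k * n + n <= W by apply: leq_trans W_sq; nia.
  apply: (@runs_seq _ _ _ _ 2 _ 
    (fun s2 => s2 = set_reg (set_reg s1 rKey (k * n)) rHi (size (bucket n k)))).
    apply: runs_wp; rewrite /= s1_k row_k len_d; split; first lia.
    by split=> //; apply: leq_trans le_b _; lia.
  move=> s2 _ def_s2.
  pose inv2 j s' := reg s' rPos = size (collected k) + j /\
    order_ok (collected k ++ take j (bucket n k)) s'.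
  have := @runs_for W rJ (Imm 0) (Reg rHi) pop_vertex s2 (fun _ => 4) inv2.
  rewrite def_s2 /= => loop.
  apply: runs_weaken (loop _ _ _ _ _ _) _ _ => {loop} //.
  + by apply: leq_trans le_b _; lia.
  + by split; rewrite /= ?addn0 ?take0 ?cats0.
  + move=> j s3 lt_j [ag_r ag_a] s3_j [pos3 order3].
    have [key3 k3] : reg s3 rKey = k * n /\ True by rewrite ag_r.
    have lt_c : size (collected k) + j < n.
      apply: leq_trans (size_collected G R k.+1).
      by rewrite collectedS size_cat ltn_add2l.
    have lt_jn : j < n by apply: leq_trans lt_j le_b.
    have read_j : mem s3 aBucket (k * n + j) = nth 0 (map val (bucket n k)) j.
      by rewrite ag_a // bucket_d.
    have [x0 _] : exists x0 : 'I_n, True by exists d.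
    set x := nth x0 (bucket n k) j.
    have x_j : nth 0 (map val (bucket n k)) j = x by rewrite (nth_map x0).
    have x_lt := ltn_ord x.
    apply: runs_wp; rewrite /= key3 s3_j read_j x_j pos3; do 4 (split; first lia).
    split; first by rewrite /= addn1 addnS.
    move=> i; rewrite (take_nth x0) // -/x -rcons_cat size_rcons size_cat.
    rewrite size_take lt_j.
    rewrite ltnS leq_eqVlt map_rcons nth_rcons size_map size_cat size_take lt_j.
    case/predU1P=> [-> | lt_i]; first by rewrite /= eqxx ltnn.
    rewrite /= ltn_eqF // lt_i; apply: order3.
    by rewrite size_cat size_take lt_j.
  + by rewrite sum_nat_const_nat subn0 /T; lia.
  move=> s3 _ [pos3 order3]; rewrite take_size in order3.
  by split=> /=; rewrite collectedS ?size_cat.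
- rewrite leq_add2l /T big_mkord.
  rewrite (eq_bigr (fun k : 'I_n => 6 + 6 * size (bucket n k))).
  2: by move=> k _; lia.
  rewrite big_split sum_nat_const card_ord -big_distrr /=.
  suff -> : \sum_(i < n) size (bucket n i) = size (collected n).
    have := size_collected G R n; nia.
  rewrite /collected size_flatten sumnE big_map big_map.
  rewrite -(big_mkord xpredT (fun i => size (bucket n i))).
  by rewrite /index_iota subn0.
Qed.

End Sort.

(** * Testing the order *)

(* The number of colours placed on the independent side; the predecessor of the
   current vertex; the failure flag and the witnesses x, y, w of a failure; the
   result of an adjacency test; the position in the sorted sequence. *)
Notation rI := 2 (only parsing).
Notation rPrev := 13 (only parsing).
Notation rFail := 14 (only parsing).
Notation rX := 15 (only parsing).
Notation rY := 16 (only parsing).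
Notation rZ := 17 (only parsing).
Notation rA := 18 (only parsing).
Notation rPlace := 19 (only parsing).
(* The indicator of the clique and the sequence of the independent side. *)
Notation aClique := 3 (only parsing).
Notation aInd := 4 (only parsing).

Definition test_adj r u w : cmd :=
  Assign r (Read aRow (Reg u)) ;; Assign r (Add (Reg r) (Reg w)) ;;
  Assign r (Read aAdj (Reg r)).

(** The test fails for a representative w that is adjacent to the predecessor x
    of y but neither equal nor adjacent to y.  A failure is recorded and the
    loop goes on, which keeps all loops free of early exits. *)
Definition check_neighbour : cmd :=
  test_adj rA rV rW ;; Assign rT (Read aRep (Reg rW)) ;;
  If (Lt (Reg rA) (Reg rT))
    (If (Eq (Reg rW) (Reg rV)) Skip
       (Assign rFail (Val (Imm 1)) ;; Assign rX (Val (Reg rPrev)) ;;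
        Assign rY (Val (Reg rV)) ;; Assign rZ (Val (Reg rW))))
    Skip.

Definition place_colour : cmd :=
  test_adj rA rPrev rV ;; Assign rT (Read aCol (Reg rV)) ;;
  If (Eq (Reg rA) (Imm 1))
    (Write aClique (Reg rT) (Imm 1))
    (Write aInd (Reg rI) (Reg rT) ;; Assign rI (Add (Reg rI) (Imm 1))).

(** At position 0 truncated subtraction makes the vertex its own predecessor: the
    test succeeds and the vertex goes to the independent side, as in
    [consecutive]. *)
Definition check : cmd :=
  For rPlace (Imm 0) (Reg rPos)
    ((Assign rV (Read aOrder (Reg rPlace)) ;;
      Assign rT (Sub (Reg rPlace) (Imm 1)) ;;
      Assign rPrev (Read aOrder (Reg rT))) ;;
     for_neighbours rPrev check_neighbour ;;
     place_colour).

Section Check.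

Variables (n : nat) (G : sgraph 'I_n) (L : 'I_n -> seq 'I_n) (m W : nat).
Hypothesis adjL : adjacency_lists G L.
Hypothesis sum_L : \sum_(v < n) size (L v) <= 2 * m.
Hypothesis leW : (2 * m + n + 2) * (n + 2) <= W.
Variables (k : nat) (c : 'I_n -> 'I_k) (R : {set 'I_n}) (o : seq 'I_n).
Hypotheses (le_kn : k <= n) (le_on : size o <= n).
Hypothesis uniq_o : uniq o.

Definition fits (p : 'I_n * 'I_n) w : bool :=
  (w \in R) && (w != p.2) ==> adj G p.2 w.

Definition dominated (p : 'I_n * 'I_n) : bool := all (fits p) (L p.1).

Definition failure s : Prop :=
  exists x y w : 'I_n,
    [/\ reg s rX = x, reg s rY = y, reg s rZ = w &
    [/\ (x, y) \in consecutive o, adj G x w, w \in R, w != y & ~~ adj G y w]].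

Definition verdict (good : bool) s : Prop :=
  reg s rFail = 0 /\ good \/ reg s rFail = 1 /\ failure s.

Definition ind_colours (ps : seq ('I_n * 'I_n)) : seq 'I_k :=
  [seq c p.2 | p <- ps & ~~ adj G p.1 p.2].

Definition clique_colours (ps : seq ('I_n * 'I_n)) : seq 'I_k :=
  [seq c p.2 | p <- ps & adj G p.1 p.2].

Definition sides_ok ps s : Prop :=
  [/\ reg s rI = size (ind_colours ps),
      forall i, i < size (ind_colours ps) ->
        mem s aInd i = nth 0 (map val (ind_colours ps)) i &
      forall a : 'I_k, mem s aClique a = (a \in clique_colours ps)].

Definition state_ok s : Prop :=
  [/\ input_ok L s, matrix_ok G s, colouring_ok c R s, order_ok o s &
      reg s rPos = size o].

Lemma state_agree rs ars s s' : agree rs ars s s' ->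
  [&& rN \notin rs, rK \notin rs & rPos \notin rs] ->
  [&& 0 \notin ars, 1 \notin ars, aRow \notin ars, aAdj \notin ars,
      aCol \notin ars, aRep \notin ars & aOrder \notin ars] ->
  state_ok s -> state_ok s'.
Proof.
move=> ag /and3P[nN kN posN] /and5P[a0N a1N rowN adjN /and3P[colN repN ordN]].
case=> in_s mat_s [s_k s_col s_rep] ord_s s_pos; have [eq_r eq_a] := ag.
split.
- exact: input_agree ag _ _ _ in_s.
- exact: matrix_agree ag _ _ mat_s.
- by split=> [|u|u]; rewrite ?eq_r ?eq_a.
- by move=> i lt_i; rewrite eq_a ?ord_s.
by rewrite eq_r.
Qed.

Lemma W_bounds : n + 4 <= W /\ n * n + n <= W.
Proof. by split; move: leW; nia. Qed.

Lemma check_neighbour_runs ps (x y : 'I_n) pre w s :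
  state_ok s -> reg s rPrev = x -> reg s rV = y ->
  (x, y) \in consecutive o -> adj G x w ->
  verdict (ps && all (fits (x, y)) pre) s ->
  runs W check_neighbour (set_reg s rW w) (cost check_neighbour)
    (fun s' => forall j,
      verdict (ps && all (fits (x, y)) (rcons pre w)) (set_reg s' rJ j)).
Proof.
move=> [in_s [s_row s_adj] [_ _ s_rep] _ _] s_x s_y oxy xw ver.
have [W_lin W_sq] := W_bounds.
have := ltn_ord x; have := ltn_ord y; have := ltn_ord w => lt_w lt_y lt_x.
have le_yw : y * n + w <= W by apply: leq_trans W_sq; nia.
apply: runs_wp; rewrite /= s_x s_y s_row s_adj s_rep.
do 2 (split; first lia).
split; first by case: adj; lia.
split; first by case: (_ \in _); lia.
rewrite all_rcons /fits /=.
case Rw: (w \in R); last first.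
  by rewrite ltn0 /= => j; case: ver => -[f g]; [left | right].
case yw: (adj G y w) => /=.
  by move=> j; case: ver => -[f g]; [left | right]; rewrite ?implybT.
rewrite val_eqE; case: eqVneq => [_ | wNy] /=.
  by move=> j; case: ver => -[f g]; [left | right].
do 4 (split; first lia).
move=> j; right; split=> //; exists x, y, w; split=> //.
by rewrite yw.
Qed.

Lemma place_colour_runs ps (x y : 'I_n) s :
  state_ok s -> reg s rPrev = x -> reg s rV = y -> size ps < n ->
  sides_ok ps s ->
  runs W place_colour s (cost place_colour) (sides_ok (rcons ps (x, y))).
Proof.
move=> [in_s [s_row s_adj] [_ s_col _] _ _] s_x s_y lt_ps [cnt_i ind_i clique_i].
have [W_lin W_sq] := W_bounds.
have := ltn_ord x; have := ltn_ord y => lt_y lt_x; have lt_c := ltn_ord (c y).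
have le_xy : x * n + y <= W by apply: leq_trans W_sq; nia.
have le_ind : size (ind_colours ps) <= size ps.
  by rewrite size_map size_filter count_size.
apply: runs_wp; rewrite /= s_x s_y s_row s_adj s_col.
do 2 (split; first lia).
split; first by case: adj; lia.
split; first lia.
have ind_rcons : ind_colours (rcons ps (x, y)) =
    if adj G x y then ind_colours ps else rcons (ind_colours ps) (c y).
  by rewrite /ind_colours filter_rcons /=; case: adj; rewrite ?map_rcons.
have clique_rcons : clique_colours (rcons ps (x, y)) =
    if adj G x y then rcons (clique_colours ps) (c y) else clique_colours ps.
  by rewrite /clique_colours filter_rcons /=; case: adj; rewrite ?map_rcons.
rewrite /sides_ok ind_rcons clique_rcons; case xy: (adj G x y) => /=.
  split; first lia.
  split=> //= a; rewrite mem_rcons inE val_eqE /= clique_i.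
  by rewrite eq_sym; case: eqP.
split; first lia.
rewrite cnt_i; split.
  by apply: leq_trans W_lin; rewrite leq_add // (leq_trans le_ind) // ltnW.
split=> //; rewrite size_rcons /= ?addn1 // => i.
rewrite ltnS leq_eqVlt map_rcons nth_rcons size_map.
case/predU1P=> [-> | lt_i]; first by rewrite !eqxx ltnn.
by rewrite ltn_eqF // lt_i ind_i.
Qed.

(** Each vertex is the predecessor of at most one other vertex, but the first one
    is also its own predecessor, so that its list is read twice. *)
Lemma sum_consecutive_degrees :
  \sum_(p <- consecutive o) size (L p.1) <= 4 * m.
Proof.
have sum_le (r : seq 'I_n) : uniq r -> \sum_(v <- r) size (L v) <= 2 * m.
  move=> uniq_r; apply: leq_trans sum_L; rewrite big_uniq //=.
  by rewrite [leqRHS](bigID (fun v => v \in r)) leq_addr.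
apply: (@leq_trans (\sum_(v <- take 1 o ++ o) size (L v))).
  rewrite /consecutive; move: o (take 1 o ++ o) => r s.
  elim: r s => [|y r IHr] [|x s];
    rewrite /= ?big_nil ?big_cons //.
  by rewrite leq_add2l.
rewrite big_cat /=.
apply: leq_trans (leq_add (sum_le _ (take_uniq 1 uniq_o)) (sum_le _ uniq_o)) _.
by rewrite -mulnDl.
Qed.

Lemma check_runs s :
  state_ok s -> reg s rFail = 0 -> reg s rI = 0 -> mem s aClique =1 (fun=> 0) ->
  runs W check s (2 + 40 * n + 20 * (4 * m))
    (fun s' => [/\ state_ok s', sides_ok (consecutive o) s' &
       verdict (all dominated (consecutive o)) s']).
Proof.
move=> st_s fail0 i0 clique0; have [W_lin W_sq] := W_bounds.
pose inv i s' := sides_ok (take i (consecutive o)) s' /\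
  verdict (all dominated (take i (consecutive o))) s'.
pose C := cost check_neighbour + 3.
pose T i := 3 +
  ((5 + C * nth 0 [seq size (L p.1) | p <- consecutive o] i) +
   cost place_colour).
have [_ _ _ _ s_pos] := st_s.
have := @runs_for W rPlace (Imm 0) (Reg rPos) _ s T inv.
rewrite /= s_pos => loop; apply: runs_weaken (loop _ _ _ _ _ _ _) _ _ => {loop} //.
- exact: leq_trans le_on (leq_trans (leq_addr _ _) W_lin).
- split; last by left; rewrite take0.
  by rewrite take0; split=> //= a; rewrite clique0.
- move=> i s1 lt_i ag s1_i [sides1 ver1].
  have [x0 _] : exists x0 : 'I_n, True by case: (o) lt_i => // x; exists x.
  have st1 : state_ok s1 by apply: state_agree ag _ _ st_s.
  have lt_ci : i < size (consecutive o) by rewrite size_consecutive.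
  set x := nth x0 o i.-1; set y := nth x0 o i.
  have nth_i : nth (x0, x0) (consecutive o) i = (x, y).
    by rewrite (consecutiveE x0) (nth_map 0) ?size_iota // nth_iota.
  have oxy : (x, y) \in consecutive o by rewrite -nth_i mem_nth.
  have [in1 mat1 col1 ord1 pos1] := st1.
  have lt_i1 : i.-1 < size o by apply: leq_ltn_trans lt_i; apply: leq_pred.
  have read_x : mem s1 aOrder i.-1 = x by rewrite ord1 // (nth_map x0).
  have read_y : mem s1 aOrder i = y by rewrite ord1 // (nth_map x0).
  have take_i :
      take i.+1 (consecutive o) = rcons (take i (consecutive o)) (x, y).
    by rewrite (take_nth (x0, x0)) ?nth_i.
  have lt_in : i < n by apply: leq_trans lt_i le_on.
  apply: runs_weaken (_ : runs W _ s1
    (3 + ((5 + C * size (L x)) + cost place_colour))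
    (fun s' => inv i.+1 (set_reg s' rPlace i.+1))) _ _ => //; last first.
    by rewrite /T (nth_map (x0, x0)) // nth_i.
  apply: (@runs_seq _ _ _ _ _ _
    (fun s2 => s2 = set_reg (set_reg (set_reg s1 rV y) rT i.-1) rPrev x)).
    apply: runs_wp; rewrite /= s1_i subn1 read_y read_x.
    by have := ltn_ord x; have := ltn_ord y; do 3 (split; first lia).
  move=> s2 _ def_s2.
  have [ag2 s2_v s2_x] : [/\ agree [:: rV; rT; rPrev] [::] s1 s2,
      reg s2 rV = y & reg s2 rPrev = x].
    rewrite def_s2; split=> //; split=> // r; rewrite !inE !negb_or /=.
    by case/and3P=> /negPf-> /negPf-> /negPf->.
  have st2 : state_ok s2 by apply: state_agree ag2 _ _ st1.
  have [in2 _ _ _ _] := st2.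
  pose inv2 pre s' :=
    verdict (all dominated (take i (consecutive o)) && all (fits (x, y)) pre) s'.
  apply: runs_seq.
    apply: (runs_neighbours sum_L leW (v := rPrev) (u := x) (Inv := inv2)) => //.
    + by move=> *; rewrite /inv2 andbT def_s2.
    move=> pre w post s3 def_L ag3 inv3.
    apply: (check_neighbour_runs (y := y)) => //.
    + exact: state_agree ag3 _ _ st2.
    + by rewrite (proj1 ag3).
    + by rewrite (proj1 ag3).
    by rewrite -(mem_neighbours adjL) def_L mem_cat mem_head orbT.
  move=> s3 ag3 inv3.
  apply: runs_weaken (place_colour_runs (ps := take i (consecutive o))
    (x := x) (y := y) _ _ _ _ _) _ _ => //.
  + exact: state_agree ag3 _ _ st2.
  + by rewrite (proj1 ag3).
  + by rewrite (proj1 ag3).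
  + by rewrite size_take lt_ci.
  + have [cnt1 ind1 clq1] := sides1; rewrite /sides_ok.
    rewrite (proj1 ag3) // (proj1 ag2) //; split=> // [e lt_e|a].
      by rewrite (proj2 ag3) // (proj2 ag2) // ind1.
    by rewrite (proj2 ag3) // (proj2 ag2) // clq1.
  move=> s4 [ag4 _] sides4; split; rewrite /= take_i; first exact: sides4.
  rewrite all_rcons andbC.
  case: inv3 => -[f g]; [left | right]; rewrite /= ?ag4 //.
  by split=> //; move: g; rewrite /failure /= !ag4.
- set ds := [seq size (L p.1) | p <- consecutive o] in T *.
  have size_ds : size ds = size o by rewrite size_map size_consecutive.
  have sum_ds : \sum_(0 <= i < size o) nth 0 ds i <= 4 * m.
    rewrite -size_ds -(big_nth 0 xpredT id) big_map.
    exact: sum_consecutive_degrees.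
  rewrite -addnA leq_add2l.
  rewrite (eq_bigr (fun i => 10 + cost place_colour + C * nth 0 ds i)).
    rewrite big_split /= sum_nat_const_nat subn0 -big_distrr /=.
    by apply: leq_add; rewrite ?[40 * n]mulnC leq_mul.
  by move=> i _; rewrite /T; lia.
move=> s' ag [sides' ver']; rewrite take_oversize ?size_consecutive // in sides' ver'.
by split=> //; apply: state_agree ag _ _ st_s.
Qed.

End Check.

(** * Extracting an obstruction *)

(* The result of a second adjacency test; the vertex z that completes an
   alternating 4-cycle; vertices p, p' and s, with s adjacent to p only; vertices
   q, q' and u, with u adjacent to q only; the arguments of a search for a vertex
   that tells two given ones apart. *)
Notation rB := 20 (only parsing).
Notation rE := 21 (only parsing).
Notation rP := 22 (only parsing).
Notation rP' := 23 (only parsing).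
Notation rS := 24 (only parsing).
Notation rQ := 25 (only parsing).
Notation rQ' := 26 (only parsing).
Notation rU := 27 (only parsing).
Notation rC := 28 (only parsing).
Notation rC' := 29 (only parsing).

Fixpoint write_cells i rs : cmd :=
  if rs is r :: rs' then Write aCol (Imm i) (Reg r) ;; write_cells i.+1 rs'
  else Skip.

Definition emit o rs : cmd :=
  (Assign 0 (Val (Imm 0)) ;; Assign 1 (Val (Imm (obs_code o)))) ;;
  write_cells 0 rs.

Definition branch u v p q : cmd :=
  test_adj rA u v ;; If (Eq (Reg rA) (Imm 0)) p q.

Definition search p : cmd := For rV (Imm 0) (Reg rN) p.

Definition exchange_candidate : cmd :=
  Assign rT (Read aRep (Reg rV)) ;; test_adj rA rY rV ;; test_adj rB rX rV ;;
  If (Eq (Reg rV) (Reg rX)) Skip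
    (If (Lt (Reg rB) (Reg rA))
       (If (Eq (Reg rT) (Imm 1)) (Assign rE (Val (Reg rV))) Skip)
       Skip).

Definition distinguisher_candidate : cmd :=
  test_adj rA rV rC ;; test_adj rB rV rC' ;;
  If (Lt (Reg rB) (Reg rA))
    (Assign rP (Val (Reg rC)) ;; Assign rP' (Val (Reg rC')) ;;
     Assign rS (Val (Reg rV)))
    (If (Lt (Reg rA) (Reg rB))
      (Assign rP (Val (Reg rC')) ;; Assign rP' (Val (Reg rC)) ;;
       Assign rS (Val (Reg rV)))
      Skip).

(** Here p, q, p', q' is an induced 4-cycle, s tells its diagonal p, p' apart and u
    tells its diagonal q, q' apart.  If s or u is not adjacent to both ends of
    the other diagonal, it forms a P4 with three vertices of the cycle.
    Otherwise all six vertices form the complement of 2P3 if s and u are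
    adjacent, and u, p', q', s is a P4 if they are not. *)
Definition split_C4 : cmd :=
  branch rS rQ (emit ObsP4 [:: rS; rP; rQ; rP'])
  (branch rS rQ' (emit ObsP4 [:: rS; rP; rQ'; rP'])
  (branch rU rP (emit ObsP4 [:: rU; rQ; rP; rQ'])
  (branch rU rP' (emit ObsP4 [:: rU; rQ; rP'; rQ'])
  (branch rS rU (emit ObsP4 [:: rU; rP'; rQ'; rS])
    (emit ObsCo2P3 [:: rP; rP'; rS; rQ; rQ'; rU]))))).

(** The vertex z completes x, y and w to an alternating 4-cycle with edges xw and
    yz and non-edges xz and yw.  Depending on the pairs xy and wz, which are
    tested next, this is a 2K2, a P4 or a C4, and only the last case needs more
    work. *)
Definition obstruct : cmd :=
  search exchange_candidate ;;
  branch rX rY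
    (branch rZ rE (emit Obs2K2 [:: rX; rZ; rY; rE])
                  (emit ObsP4 [:: rX; rZ; rE; rY]))
    (branch rZ rE (emit ObsP4 [:: rZ; rX; rY; rE])
      ((Assign rC (Val (Reg rZ)) ;; Assign rC' (Val (Reg rY))) ;;
       search distinguisher_candidate ;;
       (Assign rQ (Val (Reg rP)) ;; Assign rQ' (Val (Reg rP')) ;;
        Assign rU (Val (Reg rS)) ;;
        Assign rC (Val (Reg rX)) ;; Assign rC' (Val (Reg rE))) ;;
       search distinguisher_candidate ;;
       split_C4)).

Section Obstruct.

Variables (n : nat) (G : sgraph 'I_n) (L : 'I_n -> seq 'I_n) (m W : nat).
Hypothesis sum_L : \sum_(v < n) size (L v) <= 2 * m.
Hypothesis leW : (2 * m + n + 2) * (n + 2) <= W.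

Definition answered s : Prop :=
  exists w : certificate n, outputs s w /\ valid_certificate G w.

(** The registers in the list rs hold vertices, named by f.  The leaves of the
    decision tree can then be described by lists of registers. *)
Definition named s (rs : seq nat) (f : nat -> 'I_n) : Prop :=
  forall r, r \in rs -> reg s r = f r.

Lemma named_agree rs ars s s' names f :
  agree rs ars s s' -> ~~ has (fun r => r \in rs) names ->
  named s names f -> named s' names f.
Proof.
move=> [eq_r _] /hasPn disj named_s r names_r.
by rewrite eq_r ?named_s ?disj.
Qed.

Lemma write_cells_runs i rs s :
  (forall r, r \in rs -> reg s r <= W) ->
  runs W (write_cells i rs) s (size rs).+1 (fun s' =>
    (forall r, reg s' r = reg s r) /\
    forall j, mem s' aCol j =
      if i <= j < i + size rs then reg s (nth 0 rs (j - i)) else mem s aCol j).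
Proof.
elim: rs i s => [|r rs IHrs] i s le_W.
  exists 1, s; split=> //; first exact: ExecSkip.
  split=> // j; rewrite addn0; case: ifP => //; lia.
apply: (@runs_seq _ _ _ _ 1 _ (fun s' => s' = set_mem s aCol i (reg s r))).
  by apply: runs_wp; rewrite /= le_W ?mem_head.
move=> _ _ ->; apply: runs_weaken (IHrs i.+1 _ _) _ _ => //= [r' rs_r'|].
  by apply: le_W; rewrite inE rs_r' orbT.
move=> s' _ [eq_r cells]; split=> // j; rewrite cells /=.
case: (ltngtP i j) => [lt_ij | lt_ji | ->].
- by rewrite addSnnS subnS; case: (j - i) (subn_gt0 i j); rewrite lt_ij.
- by [].
by rewrite subnn addnS ltnS leq_addr.
Qed.

Lemma emit_runs o rs names f s t :
  named s names f -> all (fun r => (1 < r) && (r \in names)) rs ->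
  size rs = obs_size o -> 9 <= t ->
  induced_embedding (obs_graph o) G (fun i => nth (f 0) (map f rs) i) ->
  runs W (emit o rs) s t answered.
Proof.
move=> s_f /allP rs_ok size_rs le_t emb.
have W_lin : n + 4 <= W by move: leW; nia.
have code_W : obs_code o <= W by case: (o) => /=; lia.
have le_size : size rs <= 6 by rewrite size_rs; case: (o).
apply: runs_weaken (_ : runs W _ _ (2 + (size rs).+1) answered) _ _ => //;
  last by apply: leq_trans le_t; rewrite add2n !ltnS.
  apply: (@runs_seq _ _ _ _ 2 _
    (fun s' => s' = set_reg (set_reg s 0 0) 1 (obs_code o))).
    by apply: runs_wp.
  move=> _ _ ->.
  have named_rs r : r \in rs ->
      reg (set_reg (set_reg s 0 0) 1 (obs_code o)) r = f r.
    move=> rs_r; have /andP[] := rs_ok r rs_r.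
    by case: r rs_r => [|[|r]] rs_r //= _; apply: s_f.
  apply: runs_weaken (write_cells_runs _ _) _ _ => [r rs_r||s' _ [eq_r cells]] //.
    by rewrite named_rs //; have := ltn_ord (f r); lia.
  exists (@No _ o (fun i => nth (f 0) (map f rs) i)); split=> //.
  split; rewrite ?eq_r // => i.
  rewrite cells add0n subn0 size_rs ltn_ord named_rs ?mem_nth ?size_rs //.
  by rewrite (nth_map 0) ?size_rs.
Qed.

(** The time allowance 4 pays for the adjacency test and the branching. *)
Lemma branch_runs u v p q s (f : nat -> 'I_n) names t Q :
  matrix_ok G s -> named s names f -> u \in names -> v \in names ->
  rA \notin names ->
  (forall s', matrix_ok G s' -> agree [:: rA] [::] s s' -> named s' names f ->
    ~~ adj G (f u) (f v) -> runs W p s' t Q) ->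
  (forall s', matrix_ok G s' -> agree [:: rA] [::] s s' -> named s' names f ->
    adj G (f u) (f v) -> runs W q s' t Q) ->
  runs W (branch u v p q) s (4 + t) Q.
Proof.
move=> mat_s s_f u_in v_in rA_out run_p run_q; have [s_row s_adj] := mat_s.
have W_sq : n * n + n <= W by move: leW; nia.
have le_uv : f u * n + f v <= W.
  by apply: leq_trans W_sq; have := ltn_ord (f u); have := ltn_ord (f v); nia.
have vNA : v == rA = false by apply: contraNF rA_out => /eqP <-.
rewrite (addSnnS 3 t); apply: (@runs_seq _ _ _ _ 3 _ (fun s' => [/\ matrix_ok G s',
  agree [:: rA] [::] s s', named s' names f & reg s' rA = adj G (f u) (f v)])).
  have run (Q' : state -> Prop) :
      wp W (test_adj rA u v) s Q' -> runs W (test_adj rA u v) s 3 Q'.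
    exact: runs_wp.
  apply: run; rewrite /= s_f // s_row vNA s_f // s_adj.
  do 2 (split; first lia).
  split; first by case: adj; lia.
  have ag a b e : agree [:: rA] [::] s
      (set_reg (set_reg (set_reg s rA a) rA b) rA e).
    by split=> //= r; rewrite inE => /negPf->.
  split=> //.
  apply: named_agree (ag _ _ _) _ s_f.
  by apply/hasPn=> r names_r; rewrite inE; apply: contraNneq rA_out => <-.
move=> s' _ [mat' ag' s'_f s'_A]; apply: runs_if => /=; rewrite s'_A.
  by rewrite eqb0 => uv; apply: run_p.
by rewrite eqb0 negbK => uv; apply: run_q.
Qed.

(** A search goes through all vertices and keeps the last candidate that it
    meets. *)
Lemma search_runs p s (P : pred 'I_n) (found : state -> Prop) t :
  input_ok L s -> rV \notin wregs p -> rN \notin wregs p ->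
  (exists z, P z) ->
  (forall (v : 'I_n) s1, agree (rV :: wregs p) (warrs p) s s1 -> reg s1 rV = v ->
    runs W p s1 t (fun s2 => P v \/ found s1 -> found s2)) ->
  (forall s1 e, found s1 -> found (set_reg s1 rV e)) ->
  runs W (search p) s (2 + (t + 2) * n) found.
Proof.
move=> in_s rVN rNN [z Pz] step stable.
apply: runs_weaken (runs_vertices sum_L leW (a := t) (b := 0)
  (Inv := fun k s1 => (exists2 v : 'I_n, v < k & P v) -> found s1)
  in_s _ _ _ _) _ _ => //.
- by case.
- move=> v s1 ag s1_v inv; rewrite mul0n addn0.
  apply: runs_weaken (step v s1 ag s1_v) _ _ => // s2 _ found2.
  case=> u; rewrite ltnS leq_eqVlt => /predU1P[/val_inj-> Pv | lt_uv Pu].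
    by apply/stable/found2; left.
  by apply/stable/found2; right; apply: inv; exists u.
- by rewrite mul0n addn0.
by move=> s' _; apply; exists z.
Qed.

Lemma split_C4_runs f s :
  matrix_ok G s -> named s [:: rP; rP'; rS; rQ; rQ'; rU] f ->
  adj G (f rS) (f rP) -> ~~ adj G (f rS) (f rP') -> ~~ adj G (f rP) (f rP') ->
  adj G (f rU) (f rQ) -> ~~ adj G (f rU) (f rQ') -> ~~ adj G (f rQ) (f rQ') ->
  adj G (f rP) (f rQ) -> adj G (f rP) (f rQ') ->
  adj G (f rP') (f rQ) -> adj G (f rP') (f rQ') ->
  runs W split_C4 s 29 answered.
Proof.
have symG : symmetric (adj G) by apply: adj_sym.
move=> mat_s s_f sp sp' pp' uq uq' qq' pq pq' p'q p'q'.
apply: (branch_runs (t := 25) mat_s s_f) => // {mat_s s_f} s1 mat1 _ s1_f sq.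
  by apply: (emit_runs s1_f) => //; apply: P4_embedding => //; rewrite symG.
apply: (branch_runs (t := 21) mat1 s1_f) => // {mat1 s1_f} s2 mat2 _ s2_f sq'.
  by apply: (emit_runs s2_f) => //; apply: P4_embedding => //; rewrite symG.
apply: (branch_runs (t := 17) mat2 s2_f) => // {mat2 s2_f} s3 mat3 _ s3_f up.
  by apply: (emit_runs s3_f) => //; apply: P4_embedding => //; rewrite symG.
apply: (branch_runs (t := 13) mat3 s3_f) => // {mat3 s3_f} s4 mat4 _ s4_f up'.
  by apply: (emit_runs s4_f) => //; apply: P4_embedding => //; rewrite symG.
apply: (branch_runs (t := 9) mat4 s4_f) => // {mat4 s4_f} s5 mat5 _ s5_f su.
  by apply: (emit_runs s5_f) => //; apply: P4_embedding => //; rewrite symG.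
apply: (emit_runs s5_f) => //; apply: co_two_P3_embedding => //; try by rewrite symG.
by move=> u v; rewrite !inE => /or3P[]/eqP-> /or3P[]/eqP-> //; rewrite symG.
Qed.

Section Failure.

Variable R : {set 'I_n}.

Definition matrix_input s := input_ok L s /\ matrix_ok G s.

Lemma exchange_runs (f : nat -> 'I_n) s :
  matrix_input s -> (forall w : 'I_n, mem s aRep w = (w \in R)) ->
  named s [:: rX; rY; rZ] f ->
  (exists z, [/\ z \in R, z != f rX, adj G (f rY) z & ~~ adj G (f rX) z]) ->
  runs W (search exchange_candidate) s (2 + 20 * n) (fun s' => exists2 z : 'I_n,
    reg s' rE = z &
    [/\ z \in R, z != f rX, adj G (f rY) z & ~~ adj G (f rX) z]).
Proof.
move=> [in_s mat_s] s_rep s_f exch.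
pose P := [pred z |
  [&& z \in R, z != f rX, adj G (f rY) z & ~~ adj G (f rX) z]].
pose found (s' : state) := exists2 z : 'I_n, reg s' rE = z & P z.
apply: runs_weaken (search_runs (P := P) (found := found)
  (t := cost exchange_candidate) in_s _ _ _ _ _) _ _ => //.
- by case: exch => z [? ? ? ?]; exists z; apply/and4P.
- move=> v s1 ag s1_v; have W_sq : n * n + n + 2 <= W by move: leW; nia.
  have [s1_row s1_adj] := matrix_agree ag isT isT mat_s.
  have s1_f : named s1 [:: rX; rY; rZ] f by apply: named_agree ag _ s_f.
  have [s1_x s1_y] : reg s1 rX = f rX /\ reg s1 rY = f rY by rewrite !s1_f.
  have s1_rep : mem s1 aRep v = (v \in R) by rewrite (proj2 ag) ?s_rep.
  have le_W (u : 'I_n) : u * n + v <= n * n.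
    by have := ltn_ord u; have := ltn_ord v; nia.
  have le_Wx := le_W (f rX); have le_Wy := le_W (f rY).
  have lt_v := ltn_ord v.
  apply: runs_wp; rewrite /= s1_v s1_x s1_y s1_rep !s1_row !s1_adj.
  split; first by apply: leq_trans (leq_b1 _) _; lia.
  do 2 (split; first lia).
  split; first by apply: leq_trans (leq_b1 _) _; lia.
  do 2 (split; first lia).
  split; first by apply: leq_trans (leq_b1 _) _; lia.
  rewrite val_eqE; case: eqVneq => [-> | vNx].
      by case=> // /and4P[_ /negP[]].
  case xv: (adj G (f rX) v); case yv: (adj G (f rY) v);
    case Rv: (v \in R); rewrite /= /found /= ?xv ?yv ?Rv ?andbF //=;
    try by case.
  split; first lia.
  by move=> _; exists v; rewrite // Rv vNx yv xv.
- rewrite /=; nia.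
by move=> s' _ [z s'_z /and4P[]]; exists z.
Qed.

Definition distinguished u v s : Prop :=
  exists p p' a : 'I_n, [/\ reg s rP = p, reg s rP' = p', reg s rS = a &
    [/\ (p, p') \in [:: (u, v); (v, u)], adj G a p & ~~ adj G a p']].

Lemma distinguish_runs (u v : 'I_n) s :
  matrix_input s -> reg s rC = u -> reg s rC' = v ->
  (exists z, adj G z u != adj G z v) ->
  runs W (search distinguisher_candidate) s (2 + 20 * n) (distinguished u v).
Proof.
move=> [in_s mat_s] s_u s_v dist.
apply: runs_weaken (search_runs (P := [pred z | adj G z u != adj G z v])
  (found := distinguished u v)
  (t := cost distinguisher_candidate) in_s _ _ _ _ _) _ _ => //.
- move=> z s1 ag s1_z; have W_sq : n * n + n + 2 <= W by move: leW; nia.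
  have [s1_row s1_adj] := matrix_agree ag isT isT mat_s.
  have s1_u : reg s1 rC = u by rewrite (proj1 ag).
  have s1_v : reg s1 rC' = v by rewrite (proj1 ag).
  have lt_z := ltn_ord z; have lt_u := ltn_ord u; have lt_v := ltn_ord v.
  have le_zu : z * n + u <= n * n by nia.
  have le_zv : z * n + v <= n * n by nia.
  apply: runs_wp; rewrite /= s1_z s1_u s1_v !s1_row !s1_adj.
  do 2 (split; first lia).
  split; first by apply: leq_trans (leq_b1 _) _; lia.
  do 2 (split; first lia).
  split; first by apply: leq_trans (leq_b1 _) _; lia.
  case zu: (adj G z u); case zv: (adj G z v); rewrite /= ?zu ?zv //=; try by case.
    do 3 (split; first lia); move=> _; exists u, v, z; split=> //.
    by rewrite inE eqxx zu zv.
  do 3 (split; first lia); move=> _; exists v, u, z; split=> //.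
  by rewrite !inE eqxx orbT zu zv.
- rewrite /=; nia.
Qed.

(** Representatives have distinct neighbourhoods, so both diagonals of the 4-cycle
    can be told apart. *)
Lemma obstruct_runs (x y w : 'I_n) s :
  matrix_input s -> (forall v : 'I_n, mem s aRep v = (v \in R)) ->
  {in R &, forall u v, adj G u =1 adj G v -> u = v} ->
  [/\ reg s rX = x, reg s rY = y & reg s rZ = w] ->
  [/\ x \in R, y \in R & w \in R] -> rdegree G R x <= rdegree G R y ->
  adj G x w -> w != y -> ~~ adj G y w ->
  runs W obstruct s (100 + 60 * n) answered.
Proof.
have le_v (v : 'I_n) : v <= W by move: leW (ltn_ord v); nia.
move=> mat_s s_rep twinfree [s_x s_y s_w] [Rx Ry Rw] le_deg xw wNy yNw.
pose g := [eta (fun=> x) with rX |-> x, rY |-> y, rZ |-> w].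
have exch := exchange_vertex Rx Ry Rw le_deg xw wNy yNw.
have symG : symmetric (adj G) by apply: adj_sym.
have dist u v : u \in R -> v \in R -> u != v ->
    exists z, adj G z u != adj G z v.
  move=> Ru Rv uNv; case: (pickP [pred z | adj G z u != adj G z v]) => [z ?|same].
    by exists z.
  case/eqP: uNv; apply: twinfree => // z; apply/eqP.
  by move/negbFE: (same z); rewrite /= !(symG z).
have s_g : named s [:: rX; rY; rZ] g.
  by move=> r; rewrite !inE => /or3P[]/eqP->.
apply: runs_weaken (_ : runs W _ _
  ((2 + 20 * n) + (4 + (4 + (2 + ((2 + 20 * n) +
    (5 + ((2 + 20 * n) + 29))))))) answered) _ _ => //.
  apply: runs_seq (exchange_runs mat_s s_rep s_g exch) _ => s1 ag1 [z s1_z].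
  case=> Rz zNx yz xz; have [in_s adj_s] := mat_s.
  have in1 := input_agree ag1 isT isT isT in_s.
  have mat1 := matrix_agree ag1 isT isT adj_s.
  have s1_g : named s1 [:: rX; rY; rZ] g by apply: named_agree ag1 _ s_g.
  pose h := [eta g with rE |-> z].
  have s1_h : named s1 [:: rX; rY; rZ; rE] h.
    by move=> r; rewrite !inE => /or4P[]/eqP->; rewrite // s1_g.
  apply: (branch_runs mat1 s1_h) => // s2 mat2 ag2 s2_h xy.
    apply: runs_weaken (_ : runs W _ _ (4 + 9) answered) _ _ => //; last by clear; lia.
    apply: (branch_runs mat2 s2_h) => // s3 mat3 _ s3_h wz.
      by apply: (emit_runs s3_h) => //; apply: two_K2_embedding => //; rewrite symG.
    by apply: (emit_runs s3_h) => //; apply: P4_embedding => //; rewrite symG.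
  apply: (branch_runs mat2 s2_h) => // s3 mat3 ag3 s3_h wz.
    apply: runs_weaken (_ : runs W _ _ 9 answered) _ _ => //; last by clear; lia.
    by apply: (emit_runs s3_h) => //; apply: P4_embedding => //; rewrite symG.
  have in3 : input_ok L s3.
    apply: input_agree ag3 isT isT isT _; exact: input_agree ag2 isT isT isT in1.
  have s3_reg r : r \in [:: rX; rY; rZ; rE] -> reg s3 r = h r by apply: s3_h.
  apply: (@runs_seq _ _ _ _ 2 _ (fun s4 => [/\ matrix_input s4,
    named s4 [:: rX; rY; rZ; rE] h, reg s4 rC = w & reg s4 rC' = y])).
    apply: runs_wp; rewrite /= !s3_reg //; split; first exact: (le_v (h rZ)).
    split; first exact: (le_v (h rY)).
    split=> // r r_in; rewrite -(s3_reg r r_in); move: r_in.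
    by rewrite !inE => /or4P[]/eqP->.
  move=> s4 _ [[in4 mat4] s4_h s4_c s4_c'].
  apply: runs_seq (distinguish_runs _ s4_c s4_c' (dist _ _ Rw Ry wNy)) _ => //.
  move=> s5 ag5 [q [q' [b [s5_q s5_q' s5_b [qq' bq bq']]]]].
  have in5 := input_agree ag5 isT isT isT in4.
  have mat5 := matrix_agree ag5 isT isT mat4.
  have s5_h : named s5 [:: rX; rY; rZ; rE] h by apply: named_agree ag5 _ s4_h.
  apply: (@runs_seq _ _ _ _ 5 _ (fun s6 => [/\ matrix_input s6,
    reg s6 rC = x, reg s6 rC' = z &
    [/\ reg s6 rQ = q, reg s6 rQ' = q' & reg s6 rU = b]])).
    apply: runs_wp; rewrite /= s5_q s5_q' s5_b !s5_h //=.
  move=> s6 _ [[in6 mat6] s6_c s6_c' [s6_q s6_q' s6_b]].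
  have xNz : x != z by rewrite eq_sym.
  apply: runs_seq (distinguish_runs _ s6_c s6_c' (dist _ _ Rx Rz xNz)) _ => //.
  move=> s7 ag7 [p [p' [a [s7_p s7_p' s7_a [pp' ap ap']]]]].
  have mat7 := matrix_agree ag7 isT isT mat6.
  pose e := [eta (fun=> x) with rP |-> p, rP' |-> p', rS |-> a,
                                rQ |-> q, rQ' |-> q', rU |-> b].
  have s7_e : named s7 [:: rP; rP'; rS; rQ; rQ'; rU] e.
    move=> r; rewrite !inE => /or3P[/eqP->|/eqP->|/or4P[]/eqP->] //=;
      by rewrite (proj1 ag7).
  rewrite /= in xy wz.
  have cross u v : u \in [:: p; p'] -> v \in [:: q; q'] -> adj G u v.
    move: pp' qq'; rewrite !inE !xpair_eqE.
    by case/orP=> /andP[/eqP-> /eqP->]; case/orP=> /andP[/eqP-> /eqP->];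
      case/orP=> /eqP->; case/orP=> /eqP->; rewrite // symG.
  have pNp' : ~~ adj G p p'.
    by move: pp'; rewrite !inE !xpair_eqE;
      case/orP=> /andP[/eqP-> /eqP->]; rewrite // symG.
  have qNq' : ~~ adj G q q'.
    by move: qq'; rewrite !inE !xpair_eqE;
      case/orP=> /andP[/eqP-> /eqP->]; rewrite // symG.
  by apply: (split_C4_runs mat7 s7_e) => //=; apply: cross; rewrite !inE eqxx ?orbT.
by clear; lia.
Qed.

End Failure.

End Obstruct.

(** * The algorithm *)

Definition recognize : cmd :=
  build ;; colour ;; distribute ;; collect ;; check ;;
  If (Eq (Reg rFail) (Imm 0)) (Assign 0 (Val (Imm 1))) obstruct.

Section Recognize.

Variables (n : nat) (G : sgraph 'I_n) (L : 'I_n -> seq 'I_n) (m W : nat).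
Hypothesis adjL : adjacency_lists G L.
Hypothesis sum_L : \sum_(v < n) size (L v) <= 2 * m.
Hypothesis leW : (2 * m + n + 2) * (n + 2) <= W.

Lemma rdegree_consecutive (R : {set 'I_n}) p :
  p \in consecutive (collected G R n) ->
  rdegree G R p.1 <= rdegree G R p.2.
Proof.
set o := collected G R n; have := sorted_collected G R n; rewrite -/o.
have [x0 _] : exists x0 : 'I_n, True by exists p.1.
rewrite (consecutiveE x0) => /(pairwiseP x0) mono /mapP[i].
rewrite mem_iota add0n => /= lt_i ->; case: i lt_i => // i lt_i.
by apply: mono; rewrite // inE ltnW.
Qed.

(** Each colour belongs to exactly one representative, hence to exactly one of
    the consecutive pairs, which puts it on exactly one of the two sides. *)
Lemma clique_coloursE k (c : 'I_n -> 'I_k) (R : {set 'I_n}) o a :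
  twin_colouring G c R -> uniq o -> o =i R ->
  (a \in clique_colours G c (consecutive o)) =
  (a \notin ind_colours G c (consecutive o)).
Proof.
move=> [_ onto inj_c] uniq_o mem_o; set ps := consecutive o.
have perm_o : perm_eq (clique_colours G c ps ++ ind_colours G c ps) (map c o).
  rewrite /clique_colours /ind_colours -map_cat.
  rewrite -[in X in perm_eq _ X](map_snd_consecutive o) -map_comp; apply: perm_map.
  by apply/permPl; apply: perm_filterC.
have uniq_c : uniq (map c o).
  by rewrite map_inj_in_uniq // => u v; rewrite !mem_o; apply: inj_c.
have a_in : a \in clique_colours G c ps ++ ind_colours G c ps.
  have [v Rv <-] := onto a.
  by rewrite (perm_mem perm_o) map_f // mem_o.
move: uniq_c; rewrite -(perm_uniq perm_o) cat_uniq => /and3P[_ /hasPn disj _].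
move: a_in; rewrite mem_cat; case: (boolP (a \in ind_colours G c ps)).
  by move/disj/negbTE=> ->.
by rewrite orbF.
Qed.

Lemma recognize_runs :
  runs W recognize (initial_state L) (200 * (n + m + 1)) (answered G).
Proof.
set s0 := initial_state L.
apply: runs_weaken (_ : runs W _ _ ((2 + 30 * n + 20 * (2 * m)) +
  ((2 + 20 * n) + ((2 + 20 * n + 5 * (2 * m)) + ((2 + 20 * n) +
  ((2 + 40 * n + 20 * (4 * m)) + (100 + 60 * n).+1)))))
  (answered G)) _ _ => //;
  last by lia.
apply: runs_seq (build_runs adjL sum_L leW) _ => s1 ag1 [in1 mat1 nodes1].
have zero1 a i : a \notin 0 :: 1 :: warrs build -> mem s1 a i = 0.
  rewrite in_cons negb_or => /andP[a0]; rewrite in_cons negb_or => /andP[a1 aN].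
  rewrite (proj2 ag1) //.
  by case: a a0 a1 {aN} => [|[|]].
apply: runs_seq (colour_runs sum_L leW in1 nodes1 _ _ _) _;
  try by [move=> i; rewrite zero1 | rewrite (proj1 ag1)].
move=> s2 ag2 [k [c [R [le_kn [col colour2]]]]].
have in2 := input_agree ag2 isT isT isT in1.
have mat2 := matrix_agree ag2 isT isT mat1.
have [_ _ rep2] := colour2.
apply: runs_seq (distribute_runs adjL sum_L leW in2 mat2 rep2 _) _.
  by move=> i; rewrite (proj2 ag2) ?zero1.
move=> s3 ag3 [in3 mat3 buckets3].
apply: runs_seq (collect_runs sum_L leW in3 mat3 buckets3 _) _.
  by rewrite (proj1 ag3) // (proj1 ag2) // (proj1 ag1).
move=> s4 ag4 [pos4 order4]; set o := collected G R n in pos4 order4.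
have uniq_o : uniq o by apply: uniq_collected.
have mem_o : o =i R by move=> v; rewrite mem_collected rdegree_lt andbT.
have in4 := input_agree ag4 isT isT isT in3.
have mat4 := matrix_agree ag4 isT isT mat3.
have st4 : state_ok G L c R o s4.
  split=> //; have [k2 col2 _] := colour2.
  split=> [|u|u]; first by rewrite (proj1 ag4) // (proj1 ag3).
    by rewrite (proj2 ag4) // (proj2 ag3).
  by rewrite (proj2 ag4) // (proj2 ag3).
apply: runs_seq (check_runs adjL sum_L leW le_kn _ uniq_o st4 _ _ _) _.
- exact: size_collected.
- by rewrite (proj1 ag4) // (proj1 ag3) // (proj1 ag2) // (proj1 ag1).
- by rewrite (proj1 ag4) // (proj1 ag3) // (proj1 ag2) // (proj1 ag1).
- move=> i; rewrite (proj2 ag4) // (proj2 ag3) // (proj2 ag2) // zero1 //.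
move=> s5 _ [[in5 mat5 [k5 col5 rep5] _ _] [i5 ind5 clique5] ver5].
have W_gt0 : 0 < W by move: leW; nia.
apply: runs_if => /= fail5.
  case: ver5 => [[_ good] | [f1]]; last by rewrite f1 in fail5.
  set I := ind_colours G c (consecutive o) in i5 ind5 *.
  apply: runs_weaken (_ : runs W _ _ 1 (answered G)) _ _ => //.
  apply: runs_wp; split=> //=; exists (@Yes n k c (~: [set x in I]) I); split.
    split=> // a; rewrite /= clique5 (clique_coloursE _ col) //.
    by rewrite !inE.
  apply: twin_chain_certificate col uniq_o mem_o _ => p o_p w Rw pw wNp.
  have /allP/(_ w) := allP good p o_p; rewrite (mem_neighbours adjL).
  by move/(_ pw); rewrite /fits Rw wNp.
case: ver5 => [[f0] | [_ [x [y [w [s_x s_y s_w [oxy xw Rw wNy yw]]]]]]].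
  by rewrite f0 in fail5.
have [twins onto inj_c] := col.
have Rxy : x \in R /\ y \in R.
  have [x0 _] : exists x0 : 'I_n, True by exists x.
  move: oxy; rewrite (consecutiveE x0) => /mapP[i]; rewrite mem_iota => /= lt_i.
  case=> -> ->; rewrite -!mem_o !mem_nth //.
  exact: leq_ltn_trans (leq_pred i) lt_i.
have [Rx Ry] := Rxy.
apply: (obstruct_runs sum_L leW (x := x) (y := y) (w := w)) => //.
- by move=> u v Ru Rv /twins; apply: inj_c.
exact: rdegree_consecutive oxy.
Qed.

End Recognize.

Theorem theorem11 :
  exists (p : cmd) (c d : nat),
  forall (n : nat) (G : sgraph 'I_n) (L : 'I_n -> seq 'I_n),
    adjacency_lists G L ->
    exists (t : nat) (s : state) (w : certificate n),
      [/\ exec ((n + #|edges G| + 2) ^ d) p (initial_state L) t s,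
          t <= c * (n + #|edges G| + 1),
          outputs s w,
          valid_certificate G w
        & is_yes w <-> fully_threshold_colourable G].
Proof.
exists recognize, 200, 3 => n G L adjL.
(* With N = n + m + 2, the bound is at most N * (2 * N), and 2 <= N. *)
have leW : (2 * #|edges G| + n + 2) * (n + 2) <= (n + #|edges G| + 2) ^ 3.
  rewrite !expnS expn0 muln1 [leqLHS]mulnC.
  by rewrite leq_mul //; [lia | nia].
have [t [s [ex le_t [w [out valid]]]]] :=
  recognize_runs adjL (sum_degrees adjL) leW.
by exists t, s, w; split=> //; apply: valid_certificate_answer.
Qed.
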